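(* For every $n\ge 1$, the space $\mathcal{C}act^1(n)$ of normalized spineless cacti with $n$ lobes is homeomorphic to the CW complex $K(n)$.
   Context: **Ribbon graphs.** A graph $\Gamma$ consists of finite sets $V(\Gamma)$ (vertices), $F(\Gamma)$ (flags), a map $\delta:F\to V$ and a fixed-point-free involution $\imath:F\to F$; edges are orbits of $\imath$; $F(v)=\delta^{-1}(v)$. Graphs are connected. A ribbon graph is a graph with a cyclic order on every $F(v)$; $N(f)$ denotes the flag following $\imath(f)$ in the cyclic order at $\delta(\imath(f))$; the orbits of $N$ are the cycles. The genus $g$ is given by $2-2g=\#V-\#E+\#\text{cycles}$. A marked spineless treelike ribbon graph is a genus $0$ ribbon graph with a distinguished flag $f_0$ such that, with $c_0$ the cycle containing $f_0$ and $v_0=\delta(f_0)$: (i) for each flag $f$, $f\in c_0$ or $\imath(f)\in c_0$; (ii) $|F(v_0)|\ge2$ and $|F(v)|\ge3$ for $v\ne v_0$. A spineless cactus with $n$ lobes is such a graph with $n+1$ cycles labelled $0,\dots,n$ ($c_0$ labelled $0$) and a metric $\mu:E(\Gamma)\to\mathbb{R}_{>0}$; $\mathcal{C}act(n)$ is the set of these (up to isomorphism). Edges are called arcs, the cycles $1,\dots,n$ lobes; the length of a lobe is the sum of the lengths of its arcs. $\mathcal{C}act^1(n)\subset\mathcal{C}act(n)$ is the subset where all $n$ lobes have length $1$. $\mathbb{P}\mathcal{C}act(n)=\mathcal{C}act(n)/\mathbb{R}_{>0}$ (rescaling $\mu$), so $\mathcal{C}act(n)=\mathbb{P}\mathcal{C}act(n)\times\mathbb{R}_{>0}$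 (second factor: total length of the arcs). **Trees.** $\mathcal{T}(n)$ is the set (up to isomorphism) of planted planar bipartite black/white trees without tails with $n$ white vertices labelled bijectively by $1,\dots,n$: finite trees with vertices coloured black or white, a black root vertex of valence one joined by the root edge to another black vertex, every edge except the root edge joining a black and a white vertex, a cyclic order on the set $E(v)$ of edges at each vertex $v$, and (edges being oriented toward the root) every leaf, i.e. non-root vertex without incoming edges, white. $N(v)$ is the next vertex toward the root, $|v|$ the number of incoming edges of $v$; so a white vertex has $|v|+1$ adjacent edges. **Topological type.** The topological type of a spineless cactus $\Gamma$ is the tree in $\mathcal{T}(n)$ with black non-root vertices $V(\Gamma)$, white vertices the cycles $c\neq c_0$ (with their labels), flags $F(\Gamma)$ (plus those of the root edge), with $\delta_\tau(f)=\delta_\Gamma(f)$, $\imath_\tau(f)=N_\Gamma(\imath_\Gamma(f))$ for $f\in c_0$, and $\delta_\tau(f)=c$, $\imath_\tau(f)=\imath_\Gamma(N_\Gamma^{-1}(f))$ for $f\in c\ne c_0$; the cyclic order at a white vertex $c$ is the reverse of the order of the cycle $c$, at a black vertex it is induced from $\Gamma$, and the root edge is attached at $v_0$ immediately before $f_0$. For a non-root edge $e=\{w,b\}$ ($w$ white, $b$ black) of the type, let $a_e$ be the arc of the lobe $w$ which, traversed in the direction of $c_0$, ends at the vertex $b$; $e\mapsto a_e$ is a bijection between non-root edges and arcs. **Degenerations.** Let $e=\{w,b\}$ be a non-root edge of $\tau\in\mathcal{T}(n)$ with $|w|\ge1$ and $e^-=\{w,b^-\}$ its predecessor in the cyclic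 order at $w$. $\partial_e(\tau)\in\mathcal T(n)$ is obtained by collapsing the angle at $w$ between $e^-$ and $e$: identify $b$ with $b^-$ (to $\bar b$) and $e$ with $e^-$ (to $\bar e$); the cyclic order at $\bar b$ is $(\bar e,A,B)$ where $A$ lists the edges at $b^-$ following $e^-$ and $B$ lists the edges at $b$ following $e$. All other structure is kept. It is the type of the cactus obtained by contracting the arc $a_e$. **Topology.** For $\tau\in\mathcal{T}(n)$ let $S(\tau)$ be the simplex with barycentric coordinates $(x_e)$ indexed by the non-root edges $e$ of $\tau$. Sending a cactus of total length $1$ to its type and its arc lengths $x_e=\mu(a_e)$ identifies $\mathbb{P}\mathcal{C}act(n)$ with $\coprod_\tau \mathrm{int}\,S(\tau)$. Give $\mathbb{P}\mathcal{C}act(n)$ the topology obtained by identifying, for each non-root edge $e=\{w,b\}$ with $|w|\ge 1$, the open face $x_e=0$ of $S(\tau)$ with $\mathrm{int}\,S(\partial_e\tau)$ (the coordinate of $\bar e$ being $x_{e^-}$, the others unchanged); thus it is a quotient of the disjoint union over $\tau$ of the subsets of $S(\tau)$ where $\sum_{e\in E(w)}x_e>0$ for every white vertex $w$. $\mathcal{C}act(n)=\mathbb{P}\mathcal{C}act(n)\times\mathbb{R}_{>0}$ has the product topology and $\mathcal{C}act^1(n)$ the subspace topology. **The complex $K(n)$.** Its $k$-cells are indexed by the $\tau\in\mathcal{T}(n)$ having exactly $k$ white edges (edges $(b,N(b))$ with $N(b)$ white). The cell of $\tau$ is $C(\tau)=\prod_{v\text{ white}}\Delta^{|v|}$, where $\Delta^{|v|}$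 has barycentric coordinates indexed by the $|v|+1$ edges $e\in E(v)$. The attaching maps identify, for each white $w$ with $|w|\ge1$ and $e\in E(w)$, the face $x_e=0$ of $C(\tau)$ with $C(\partial_e\tau)$ (coordinate of $\bar e$ equal to $x_{e^-}$, the others unchanged). *)

(* Defs.v *)
From HB Require Import structures.
From Stdlib Require Import Relations.Relation_Operators.
From mathcomp Require Import all_boot all_order all_algebra generic_quotient.
From mathcomp Require Import all_classical all_reals all_analysis.

Set Implicit Arguments.
Unset Strict Implicit.
Unset Printing Implicit Defensive.

Import Order.TTheory GRing.Theory Num.Theory.
Import numFieldNormedType.Exports.

Local Open Scope quotient_scope.
Local Open Scope classical_set_scope.

Definition homeomorphic (X Y : topologicalType) : Prop :=
  exists (f : X -> Y) (g : Y -> X),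
    [/\ continuous f, continuous g, cancel f g & cancel g f].

Record graph (V F : finType) := Graph {
  vert : F -> V;
  oflag : F -> F;
  (* the flag following f in the cyclic order at vert f *)
  csucc : F -> F }.

Section Graph.
Context {V F : finType}.
Implicit Type G : graph V F.

Definition adjacency G : rel V :=
  [rel v w | [exists f, (vert G f == v) && (vert G (oflag G f) == w)]].

(* The fourth clause says that csucc is, at each vertex v, a cyclic order on the
   set of flags F(v): the orbits of csucc are the fibres of vert. *)
Definition is_ribbon G : Prop :=
  [/\ involutive (oflag G),
      forall f, oflag G f != f,
      injective (csucc G),
      forall f f', fconnect (csucc G) f f' = (vert G f == vert G f')
    & forall v w, connect (adjacency G) v w].

Definition valence G (v : V) : nat := #|[pred f | vert G f == v]|.

Definition nedges G : nat := fcard (oflag G) F.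

(* The map N, whose orbits are the cycles. *)
Definition cnext G (f : F) : F := csucc G (oflag G f).

Definition ncycles G : nat := fcard (cnext G) F.

Definition genus0 G : Prop := (#|V| + ncycles G = nedges G + 2)%N.

End Graph.

Definition graph_iso (V F V' F' : finType) (G : graph V F) (G' : graph V' F')
    (p : V -> V') (q : F -> F') : Prop :=
  [/\ bijective p, bijective q,
      forall f, vert G' (q f) = p (vert G f),
      forall f, oflag G' (q f) = q (oflag G f)
    & forall f, csucc G' (q f) = q (csucc G f)].

Section CactusData.
Variables (R : realType) (n : nat).

(* clab f is the label of the cycle through f; clen f is the length of the edge
   carrying f. *)
Record cactus_data (V F : finType) := CactusData {
  cgraph :> graph V F;
  cbase : F;
  clab : F -> 'I_n.+1;
  clen : F -> R }.

Context {V F : finType}.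
Implicit Type c : cactus_data V F.

Definition outer c : pred F := fun f => fconnect (cnext c) (cbase c) f.

(* The second clause is an exclusive or: an edge with both flags on the outer
   cycle would be a spine. *)
Definition is_spineless_treelike c : Prop :=
  [/\ is_ribbon c /\ genus0 c,
      forall f, outer c f (+) outer c (oflag c f),
      (2 <= valence c (vert c (cbase c)))%N
    & forall v, v != vert c (cbase c) -> (3 <= valence c v)%N].

Definition is_cactus c : Prop :=
  [/\ is_spineless_treelike c,
      (forall f f', fconnect (cnext c) f f' = (clab c f == clab c f'))
        /\ (forall i, exists f, clab c f = i),
      clab c (cbase c) = ord0
    & (forall f, clen c (oflag c f) = clen c f) /\ (forall f, 0 < clen c f)%R].

Definition total_length c : R := (\sum_(f in froots (oflag c)) clen c f)%R.

(* For i != ord0 the flags on the cycle i are in bijection with its arcs. *)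
Definition cycle_length c (i : 'I_n.+1) : R :=
  (\sum_(f | clab c f == i) clen c f)%R.

Definition rescale (t : R) c : cactus_data V F :=
  CactusData c (cbase c) (clab c) (fun f => t * clen c f)%R.

End CactusData.

Arguments CactusData {R n V F}.

Definition cactus_iso (R : realType) (n : nat) (V F V' F' : finType)
    (c : cactus_data R n V F) (c' : cactus_data R n V' F')
    (p : V -> V') (q : F -> F') : Prop :=
  [/\ graph_iso c c' p q,
      cbase c' = q (cbase c),
      forall f, clab c' (q f) = clab c f
    & forall f, clen c' (q f) = clen c f].

(* Every finite graph is isomorphic to one whose vertices and flags are
   ordinals, so these represent all isomorphism classes. *)
Record ord_cactus (R : realType) (n : nat) := OrdCactus {
  cnv : nat;
  cnf : nat;
  cdata :> cactus_data R n 'I_cnv 'I_cnf;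
  cdataP : is_cactus cdata }.

HB.instance Definition _ R n := gen_eqMixin (ord_cactus R n).
HB.instance Definition _ R n := gen_choiceMixin (ord_cactus R n).

Section TreeData.
Variable n : nat.

(* tcol v is Some i if v is the white vertex labelled i, None if v is black. *)
Record tree_data (V F : finType) := TreeData {
  tgraph :> graph V F;
  tcol : V -> option 'I_n;
  troot : V }.

Context {V F : finType}.
Implicit Type t : tree_data V F.

Definition white t (v : V) : bool := tcol t v != None.

(* The number |v| of incoming edges, for v not the root: exactly one of the
   edges at v points towards the root. *)
Definition arity t (v : V) : nat := (valence t v).-1.

Definition is_tree t : Prop :=
  [/\ is_ribbon t /\ #|V| = (nedges t).+1,
      forall i : 'I_n, exists! v, tcol t v = Some i,
      [/\ ~~ white t (troot t), valence t (troot t) = 1%N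
        & forall f, vert t f = troot t -> ~~ white t (vert t (oflag t f))],
      forall f, vert t f != troot t -> vert t (oflag t f) != troot t ->
        white t (vert t f) (+) white t (vert t (oflag t f))
    & forall v, v != troot t -> arity t v = 0%N -> white t v].

(* A non-root edge has exactly one white end; it is named by its flag there.
   In this way the set E(w) of edges at a white vertex w is the set of flags
   at w. *)
Definition wflag t : Type := {f : F | white t (vert t f)}.
HB.instance Definition _ t := Finite.on (wflag t).

End TreeData.

Arguments TreeData {n V F}.

Definition tree_iso (n : nat) (V F V' F' : finType)
    (t : tree_data n V F) (t' : tree_data n V' F')
    (p : V -> V') (q : F -> F') : Prop :=
  [/\ graph_iso t t' p q,
      forall v, tcol t' (p v) = tcol t v
    & troot t' = p (troot t)].

Record ord_tree (n : nat) := OrdTree {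
  tnv : nat;
  tnf : nat;
  tdata :> tree_data n 'I_tnv 'I_tnf;
  tdataP : is_tree tdata }.

HB.instance Definition _ n := gen_eqMixin (ord_tree n).
HB.instance Definition _ n := gen_choiceMixin (ord_tree n).

(* Vertices: those of c, the lobes, and the root; the lobe labelled lift ord0 i
   (that is, i + 1) becomes the white vertex labelled i. Flags: those of c, and
   the two flags of the root edge, inr true at the base vertex and inr false at
   the root. *)
Section TopologicalType.
Variables (R : realType) (n : nat) (V F : finType) (c : cactus_data R n V F).

Definition type_vert (f : F + bool) : V + 'I_n + unit :=
  match f with
  | inl f => if unlift ord0 (clab c f) is Some i then inl (inr i)
             else inl (inl (vert c f))
  | inr true => inl (inl (vert c (cbase c)))
  | inr false => inr tt
  end.

Definition type_opp (f : F + bool) : F + bool :=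
  match f with
  | inl f => inl (if outer c f then cnext c (oflag c f)
                  else oflag c (finv (cnext c) f))
  | inr b => inr (~~ b)
  end.

(* The order at a black vertex: the flags of c there lying on the outer cycle,
   in the order induced from c, with the root edge inserted before cbase c. *)
Definition type_succ (f : F + bool) : F + bool :=
  match f with
  | inl f =>
      if outer c f then
        let g := next [seq x <- orbit (csucc c) f | outer c x] f in
        if g == cbase c then inr true else inl g
      else inl (finv (cnext c) f)
  | inr true => inl (cbase c)
  | inr false => inr false
  end.

Definition type_col (v : V + 'I_n + unit) : option 'I_n :=
  if v is inl (inr i) then Some i else None.

Definition topological_type : tree_data n (V + 'I_n + unit)%type (F + bool)%type :=
  TreeData (Graph type_vert type_opp type_succ) type_col (inr tt).

End TopologicalType.

(* For a flag h at a white vertex, naming the edge e. *)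
Section Degeneration.
Variables (n : nat) (V F : finType) (t : tree_data n V F) (h : F).

Let hm : F := finv (csucc t) h.        (* the flag of e^- *)
Let k : F := oflag t h.                (* the flag of e at b *)
Let km : F := oflag t hm.              (* the flag of e^- at b^- *)
Let b : V := vert t k.
Let bm : V := vert t km.

(* (e, A, B), written with flags at the merged black vertex. *)
Definition merged_order : seq F :=
  orbit (csucc t) km ++ behead (orbit (csucc t) k).

Definition degen_succ (f : F) : F :=
  if f \in merged_order then next merged_order f
  else if csucc t f == h then csucc t h
  else csucc t f.

(* t' is the tree obtained from t by collapsing the angle between e^- and e:
   p identifies b with b^-, and q embeds the flags of t' as the flags of t other
   than the two flags of e; the merged edge is kept under the name e^-. *)
Definition is_degeneration (V' F' : finType) (t' : tree_data n V' F')
    (p : V -> V') (q : F' -> F) : Prop :=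
  [/\ (forall v', exists v, p v = v') /\
      (forall v w, p v = p w <->
         [\/ v = w, v = b /\ w = bm | v = bm /\ w = b]),
      injective q /\ (forall f, (f \in codom q) = (f != h) && (f != k)),
      forall f', vert t' f' = p (vert t (q f')),
      (forall f', q (oflag t' f') = oflag t (q f')) /\
      (forall f', q (csucc t' f') = degen_succ (q f'))
    & (forall v, tcol t' (p v) = tcol t v) /\ troot t' = p (troot t)].

End Degeneration.

Section Quotients.

Lemma graph_iso_refl (V F : finType) (G : graph V F) : graph_iso G G id id.
Proof. by split=> //; exists id. Qed.

Lemma graph_iso_sym (V F V' F' : finType) (G : graph V F) (G' : graph V' F') p q :
  graph_iso G G' p q -> exists p' q',
    [/\ cancel p p', cancel p' p, cancel q q', cancel q' q & graph_iso G' G p' q'].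
Proof.
move=> [[p' pK p'K] [q' qK q'K] Hv Ho Hs]; exists p', q'; split=> //; split.
- by exists p.
- by exists q.
- by move=> f; apply: (can_inj pK); rewrite -Hv q'K p'K.
- by move=> f; apply: (can_inj qK); rewrite -Ho !q'K.
- by move=> f; apply: (can_inj qK); rewrite -Hs !q'K.
Qed.

Lemma graph_iso_trans (V F V' F' V'' F'' : finType) (G : graph V F)
    (G' : graph V' F') (G'' : graph V'' F'') p q p' q' :
  graph_iso G G' p q -> graph_iso G' G'' p' q' ->
  graph_iso G G'' (p' \o p) (q' \o q).
Proof.
move=> [bp bq Hv Ho Hs] [bp' bq' Hv' Ho' Hs']; split.
- exact: bij_comp.
- exact: bij_comp.
- by move=> f /=; rewrite Hv' Hv.
- by move=> f /=; rewrite Ho' Ho.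
- by move=> f /=; rewrite Hs' Hs.
Qed.

Definition tree_equiv (n : nat) : rel (ord_tree n) :=
  fun t t' => `[< exists p q, tree_iso t t' p q >].
Arguments tree_equiv {n}.

Lemma tree_equiv_is_equiv n : equiv_class_of (@tree_equiv n).
Proof.
split=> [t|t t'|t2 t1 t3].
- by apply/asboolP; exists id, id; split=> //; exact: graph_iso_refl.
- suff sym (u u' : ord_tree n) : tree_equiv u u' -> tree_equiv u' u
    by apply/idP/idP; exact: sym.
  move=> /asboolP[p [q [isoG Hc Hr]]].
  have [p' [q' [pK p'K qK q'K {}isoG]]] := graph_iso_sym isoG.
  apply/asboolP; exists p', q'; split=> // [v|]; first by rewrite -Hc p'K.
  by rewrite Hr pK.
- move=> /asboolP[p [q [iso1 Hc1 Hr1]]] /asboolP[p' [q' [iso2 Hc2 Hr2]]].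
  apply/asboolP; exists (p' \o p), (q' \o q); split=> [|v|] /=.
  + exact: graph_iso_trans iso1 iso2.
  + by rewrite Hc2 Hc1.
  + by rewrite Hr2 Hr1.
Qed.

Canonical tree_equiv_equiv n :=
  EquivRelPack (tree_equiv_is_equiv n).

Definition cactus_equiv (R : realType) (n : nat) : rel (ord_cactus R n) :=
  fun c c' => `[< exists p q, cactus_iso c c' p q >].
Arguments cactus_equiv {R n}.

Lemma cactus_equiv_is_equiv R n : equiv_class_of (@cactus_equiv R n).
Proof.
split=> [c|c c'|c2 c1 c3].
- by apply/asboolP; exists id, id; split=> //; exact: graph_iso_refl.
- suff sym (u u' : ord_cactus R n) : cactus_equiv u u' -> cactus_equiv u' u
    by apply/idP/idP; exact: sym.
  move=> /asboolP[p [q [isoG Hb Hl He]]].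
  have [p' [q' [pK p'K qK q'K {}isoG]]] := graph_iso_sym isoG.
  apply/asboolP; exists p', q'; split=> // [|f|f].
  + by rewrite Hb qK.
  + by rewrite -Hl q'K.
  + by rewrite -He q'K.
- move=> /asboolP[p [q [iso1 Hb1 Hl1 He1]]] /asboolP[p' [q' [iso2 Hb2 Hl2 He2]]].
  apply/asboolP; exists (p' \o p), (q' \o q); split=> [||f|f] /=.
  + exact: graph_iso_trans iso1 iso2.
  + by rewrite Hb2 Hb1.
  + by rewrite Hl2 Hl1.
  + by rewrite He2 He1.
Qed.

Canonical cactus_equiv_equiv R n :=
  EquivRelPack (cactus_equiv_is_equiv R n).

End Quotients.

Definition trees (n : nat) := {eq_quot (@tree_equiv n)}.
HB.instance Definition _ n := Choice.on (trees n).

Definition Cact_set (R : realType) (n : nat) := {eq_quot (@cactus_equiv R n)}.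
HB.instance Definition _ R n := Choice.on (Cact_set R n).

Local Open Scope ring_scope.

Definition proj_equiv (R : realType) (n : nat) : rel (Cact_set R n) :=
  fun c c' => `[< exists t : R, 0 < t /\
    exists p q, cactus_iso (rescale t (repr c)) (repr c') p q >].
Arguments proj_equiv {R n}.

Lemma proj_equiv_is_equiv R n : equiv_class_of (@proj_equiv R n).
Proof.
split=> [c|c c'|c2 c1 c3].
- apply/asboolP; exists 1; split=> //; exists id, id; split=> //.
    exact: graph_iso_refl.
  by move=> f /=; rewrite mul1r.
- suff sym (u u' : Cact_set R n) : proj_equiv u u' -> proj_equiv u' u
    by apply/idP/idP; exact: sym.
  move=> /asboolP[t [t0 [p [q [isoG Hb Hl He]]]]].
  have [p' [q' [pK p'K qK q'K {}isoG]]] := graph_iso_sym isoG.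
  apply/asboolP; exists t^-1; split; first by rewrite invr_gt0.
  exists p', q'; split=> // [|f|f] /=.
  + by rewrite Hb qK.
  + by have /= := Hl (q' f); rewrite q'K.
  + by have /= := He (q' f); rewrite q'K => ->; rewrite mulKf// gt_eqF.
- move=> /asboolP[t [t0 [p [q [iso1 Hb1 Hl1 He1]]]]].
  move=> /asboolP[t' [t'0 [p' [q' [iso2 Hb2 Hl2 He2]]]]].
  apply/asboolP; exists (t' * t); split; first exact: mulr_gt0.
  exists (p' \o p), (q' \o q); split=> [||f|f] /=.
  + exact: graph_iso_trans iso1 iso2.
  + by rewrite Hb2 /= Hb1.
  + by rewrite Hl2 /= Hl1.
  + by rewrite He2 /= He1 /= mulrA.
Qed.

Canonical proj_equiv_equiv R n := EquivRelPack (proj_equiv_is_equiv R n).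

Definition PCact (R : realType) (n : nat) := {eq_quot (@proj_equiv R n)}.
HB.instance Definition _ R n := Choice.on (PCact R n).

Lemma total_length_gt0 R n (c : ord_cactus R n) :
  [set x : R | 0 < x] (total_length c).
Proof.
have [[[[oppK _ _ _ _] _] _ _ _] _ _ [_ len0]] := cdataP c.
have sumC := fconnect_sym (can_inj oppK).
rewrite /= /total_length (bigD1 (froot (oflag c) (cbase c))) /=; last first.
  exact: roots_root.
by rewrite ltr_pwDl// sumr_ge0// => f _; exact: ltW.
Qed.

Section Gluing.
Variables (R : realType) (n : nat).

(* A point of the cell of t is a family of coordinates indexed by the non-root
   edges of t. *)
Definition coords (t : trees n) : topologicalType := {ptws wflag (repr t) -> R}.

Variable A : forall t : trees n, set (coords t).
Arguments A : clear implicits.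

Definition cell (t : trees n) : topologicalType := set_type (A t).

Definition cells : topologicalType := {t : trees n & cell t}.

(* y is the point of the cell of the degeneration of t along e corresponding to
   the point x of the face x_e = 0 of the cell of t. *)
Definition face_glue (x y : cells) : Prop :=
  exists h : wflag (repr (projT1 x)),
    [/\ (1 <= arity (repr (projT1 x)) (vert (repr (projT1 x)) (val h)))%N,
        val (projT2 x) h = 0
      & exists p q,
          is_degeneration (repr (projT1 x)) (val h) (repr (projT1 y)) p q /\
          (forall f' f, q (val f') = val f -> val (projT2 y) f' = val (projT2 x) f)].

Definition glue_equiv : rel cells :=
  fun x y => `[< clos_refl_sym_trans cells face_glue x y >].

Lemma glue_equiv_is_equiv : equiv_class_of glue_equiv.
Proof.
split=> [x|x y|y x z].
- by apply/asboolP; exact: rst_refl.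
- by apply/asboolP/asboolP; exact: rst_sym.
- by move=> /asboolP xy /asboolP yz; apply/asboolP; exact: rst_trans xy yz.
Qed.

Canonical glue_equiv_equiv := EquivRelPack glue_equiv_is_equiv.

Definition glued : topologicalType := quotient_topology {eq_quot glue_equiv}.

Definition to_glued (x : cells) : glued := (\pi_({eq_quot glue_equiv}) x)%qT.

End Gluing.

Arguments coords R {n}.

Section Spaces.
Variables (R : realType) (n : nat).

(* The part of the simplex S(t) where the coordinates at each white vertex do
   not all vanish. *)
Definition simplex_cell (t : trees n) : set (coords R t) :=
  [set x | [/\ forall e, 0 <= x e, \sum_e x e = 1
    & forall v, white (repr t) v ->
        0 < \sum_(e | vert (repr t) (val e) == v) x e]].

(* The topological type and the arc lengths of the representative of c of total
   length 1. A white flag f of the type is a flag of the cactus on a lobe, and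
   oflag f is a flag of the outer cycle pointing to the vertex of f: the arc
   carrying f is the arc a_e of the edge e named by f. *)
Definition has_coords (c : PCact R n) (x : cells simplex_cell) : Prop :=
  let G := repr (repr c) in
  exists p q, tree_iso (topological_type G) (repr (projT1 x)) p q /\
    forall f e, q (inl f) = val e ->
      val (projT2 x) e = clen G f / total_length G.

(* The topology on PCact transported from the glued simplices along the
   bijection has_coords. *)
Definition PCact_open (U : set (PCact R n)) : Prop :=
  exists2 W : set (glued simplex_cell), open W &
    forall c x, has_coords c x -> (U c <-> W (to_glued x)).

Lemma PCact_openT : PCact_open setT.
Proof. by exists setT => //; exact: openT. Qed.

Lemma PCact_openI : setI_closed PCact_open.
Proof.
move=> U1 U2 [W1 oW1 HW1] [W2 oW2 HW2]; exists (W1 `&` W2); first exact: openI.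
move=> c x cx; have := HW1 c x cx; have := HW2 c x cx; rewrite /setI /=; tauto.
Qed.

Lemma PCact_open_bigU (I : Type) (f : I -> set (PCact R n)) :
  (forall i, PCact_open (f i)) -> PCact_open (\bigcup_i f i).
Proof.
move=> fo; have /choice[W HW] : forall i, exists W, open W /\
    forall c x, has_coords c x -> (f i c <-> W (to_glued x)).
  by move=> i; have [W] := fo i; exists W.
exists (\bigcup_i W i); first by apply: bigcup_open => i _; have [] := HW i.
move=> c x cx; split=> -[i _ fi]; exists i => //;
  by have [_ /(_ c x cx)[]] := HW i; auto.
Qed.

HB.instance Definition _ :=
  isOpenTopological.Build (PCact R n) PCact_openT PCact_openI PCact_open_bigU.

(* The identification of Cact(n) with PCact(n) x R_{>0}. *)
Definition Cact_prod (c : Cact_set R n) : PCact R n * [set x : R | 0 < x] :=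
  ((\pi_(PCact R n) c)%qT,
   exist _ (total_length (repr c)) (mem_set (total_length_gt0 (repr c)))).

Definition Cact : topologicalType := initial_topology Cact_prod.

Definition Cact1 : set Cact :=
  [set c : Cact_set R n |
    forall i, i != ord0 -> cycle_length (repr c) i = 1].

(* The product over the white vertices v of the simplices with barycentric
   coordinates indexed by E(v), as a space of families (x_e) indexed by the
   disjoint union of the sets E(v). Its dimension is the number of white
   edges of t. *)
Definition product_cell (t : trees n) : set (coords R t) :=
  [set x | (forall e, 0 <= x e) /\
    forall v, white (repr t) v ->
      \sum_(e | vert (repr t) (val e) == v) x e = 1].

Definition K : topologicalType := glued product_cell.

End Spaces.

Arguments Cact1 R n : clear implicits.

(* Main.v *)
(* A normalized cactus has total length n, so on Cact1 the homeomorphism forgets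
   this length and multiplies each coordinate of the projective class by n, that
   is, divides it by the sum of the coordinates at its lobe. Dividing by these
   sums, and conversely by n, commutes with the face identifications, because a
   degeneration changes no sum at a white vertex when the collapsed coordinate is
   0; hence both maps are continuous on the glued spaces.

   What remains is that the cacti correspond to the points of the glued cells.
   Every point is glued to one with positive coordinates, by collapsing edges of
   coordinate 0. Such a point is unique: the word of labelled arc lengths read
   along the outer cycle, with the zero lengths skipped, is invariant under the
   gluing, and it determines a tree with positive coordinates, since in a plane
   tree the flag following f at a vertex is the first flag at this vertex met by
   the boundary walk starting from f. Finally the formulas defining the
   topological type can be solved for the cactus. *)

From HB Require Import structures.
Require Import Defs.
From Stdlib Require Import Relations.Relation_Operators.
From mathcomp Require Import all_boot all_order all_algebra generic_quotient.
From mathcomp Require Import all_classical all_reals all_analysis.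

Set Implicit Arguments.
Unset Strict Implicit.
Unset Printing Implicit Defensive.

Import Order.TTheory GRing.Theory Num.Theory.
Import numFieldNormedType.Exports.

(** * Permutations, ribbon graphs and plane trees *)

(** A point of a cell is a family of numbers on the flags of a chosen representative [repr T]. The
    choice is harmless because no automorphism of a planted plane tree moves a flag: two isomorphic
    trees have their coordinates matched in one way only. The combinatorics is carried out on flags;
    vertices and cycles are orbits and are recovered from them. It rests on one fact about plane
    trees: cutting an edge separates the tree, so the boundary walk is a single cycle. A
    degeneration is specified by a relation only, so moving a point of [K] to an interior one
    requires building the collapsed tree and proving that it is a tree. Cacti give positive
    coordinates from the start, so this reduction is applied to product cells only. The inverse map
    is chosen point by point. Its continuity does not come from the choice: the projective class of
    the chosen cactus is computed by a continuous map of glued spaces. *)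

Section Permutations.
Variable T : finType.
Implicit Types (s : T -> T) (x y a : T).

(** On the complement of [a] this is the first-return map of [s]: [a] is cut out of its cycle. It
    describes a cyclic order that loses a flag, and also the boundary walk after a contraction. *)
Definition skip s a x := if s x == a then s a else s x.

Lemma fconnect_iterP s x y : reflect (exists i, iter i s x = y) (fconnect s x y).
Proof.
apply: (iffP idP) => [xy|[i <-]]; last exact: fconnect_iter.
by exists (findex s x y); exact: iter_findex.
Qed.

Lemma fconnect_closed s (P : pred T) x y :
  (forall z, P z -> P (s z)) -> P x -> fconnect s x y -> P y.
Proof. by move=> Ps Px /fconnect_iterP[i <-]; elim: i => //= i; exact: Ps. Qed.

Lemma skip_neq s a x : injective s -> x != a -> skip s a x != a.
Proof.
move=> sI xa; rewrite /skip; case: (eqVneq (s x) a) => // sxa.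
by apply: contra xa => /eqP saa; apply/eqP/sI; rewrite sxa saa.
Qed.

(** A step of [skip s a] is one step of [s], or two when it jumps over [a]; hence the strong
    induction on the number of steps. *)
Lemma fconnect_skip s a x y : injective s -> x != a -> y != a ->
  fconnect (skip s a) x y = fconnect s x y.
Proof.
move=> sI xa ya; apply/idP/fconnect_iterP => [|[i]].
  move/(fconnect_closed (P := fconnect s x)) => H; apply/fconnect_iterP/H.
    move=> z xz; rewrite /skip; case: eqP => [<-|_].
      by rewrite -!same_fconnect1_r.
    by rewrite -same_fconnect1_r.
  exact: connect0.
elim/ltn_ind: i x xa => -[_ x _ /= ->|i IH x xa]; first exact: connect0.
have IHs j z : (j < i.+1)%N -> z != a -> skip s a x = z -> iter j s z = y ->
    fconnect (skip s a) x y.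
  by move=> ji za zE zy; apply: connect_trans (IH _ ji _ za zy); rewrite -zE fconnect1.
rewrite iterSr; case: (eqVneq (s x) a) => sxa; last first.
  by apply: (IHs i) => //; rewrite /skip (negPf sxa).
case: i IH IHs => [_ _ /= yE|i IH IHs]; first by rewrite -yE sxa eqxx in ya.
have saa := skip_neq sI xa; rewrite /skip sxa eqxx in saa.
by rewrite iterSr sxa; apply: IHs => //; rewrite /skip sxa eqxx.
Qed.

Lemma path_skip s a x p : injective s -> x != a -> last x p != a ->
  path (frel s) x p -> path (frel (skip s a)) x [seq z <- p | z != a].
Proof.
move=> sI; have [m] := ubnP (size p); elim: m x p => // m IH x [|y p] //= pm xa la.
move=> /andP[/eqP xy yp]; case: (eqVneq y a) => /= [ya|ya].
  case: p yp pm la => [|z p] /=; first by rewrite ya eqxx.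
  move=> /andP[/eqP yz zp] pm la.
  have xz : skip s a x = z by rewrite /skip xy ya eqxx -ya.
  have za : z != a by rewrite -xz skip_neq.
  rewrite za /= /IH ?xz ?eqxx//=; apply: IH => //.
  by rewrite -ltnS ltnW.
rewrite /= {1}/skip xy (negPf ya) eqxx /=; exact: IH.
Qed.

(** A duplicate-free cycle starting at [x] is the orbit of [x], so it is enough that deleting [a]
    leaves a cycle of [skip s a]. *)
Lemma orbit_skip s a x : injective s -> x != a ->
  orbit (skip s a) x = [seq z <- orbit s x | z != a].
Proof.
move=> sI xa; set p := [seq z <- _ | _].
have [q oE] : exists q, orbit s x = x :: q.
  by rewrite /orbit -orderSpred; eexists.
have pE : p = x :: [seq z <- q | z != a] by rewrite /p oE /= xa.
have pc : fcycle (skip s a) p.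
  rewrite pE /=; have := cycle_orbit sI x; rewrite oE /= => /(path_skip sI xa).
  by rewrite last_rcons => /(_ xa); rewrite filter_rcons /= xa.
rewrite (orbitE pc) ?filter_uniq ?orbit_uniq ?pE ?mem_head//=.
by rewrite eqxx rot0.
Qed.

End Permutations.

Lemma fconnect_morph (T T' : finType) (q : T -> T') (s : T -> T) (s' : T' -> T')
    x y : injective q -> (forall z, s' (q z) = q (s z)) ->
  fconnect s' (q x) (q y) = fconnect s x y.
Proof.
move=> qI qs; have qi i z : iter i s' (q z) = q (iter i s z).
  by elim: i => //= i ->.
apply/fconnect_iterP/fconnect_iterP => -[i xy]; exists i.
  by apply: qI; rewrite -qi.
by rewrite qi xy.
Qed.

Lemma adjacency_sym (V F : finType) (G : graph V F) :
  involutive (oflag G) -> symmetric (adjacency G).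
Proof.
move=> oK u w; apply/existsP/existsP => -[f /andP[fu fw]]; exists (oflag G f);
  by rewrite oK fu fw.
Qed.

Section Ribbon.
Context {V F : finType}.
Variable G : graph V F.
Hypothesis ribG : is_ribbon G.
Local Notation v := (vert G).
Local Notation o := (oflag G).
Local Notation s := (csucc G).

Lemma oflagK : involutive o.
Proof. by case: ribG. Qed.

Lemma oflag_neq f : o f != f.
Proof. by case: ribG. Qed.

Lemma csucc_inj : injective s.
Proof. by case: ribG. Qed.

Lemma fconnect_csucc f f' : fconnect s f f' = (v f == v f').
Proof. by case: ribG. Qed.

Lemma vert_csucc f : v (s f) = v f.
Proof. by apply/esym/eqP; rewrite -fconnect_csucc fconnect1. Qed.

Lemma vert_finv f : v (finv s f) = v f.
Proof. by rewrite -vert_csucc (f_finv csucc_inj). Qed.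

Lemma cnext_inj : injective (cnext G).
Proof. exact: inj_comp csucc_inj (can_inj oflagK). Qed.

(** A path of vertices lifts to flags: turn with [csucc] to the flag of the next edge, then cross
    with [oflag]. Connectedness becomes an induction principle. *)
Lemma flag_ind (P : pred F) f0 : P f0 -> (forall f, P f -> P (o f)) ->
  (forall f, P f -> P (s f)) -> forall f, P f.
Proof.
move=> P0 Po Ps.
have Pv f f' : v f = v f' -> P f -> P f'.
  by move=> /eqP; rewrite -fconnect_csucc => ff' Pf; exact: fconnect_closed Ps Pf ff'.
move=> f; have [_ _ _ _ /(_ (v f0) (v f)) /connectP[p]] := ribG.
elim: p f0 P0 => [|w p IH] f0 P0 /=; first by move=> _ /esym/Pv; exact.
move=> /andP[/existsP[g /andP[/eqP gv /eqP gw]] wp]; rewrite -gw in wp *.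
by apply: IH wp; apply: Po; exact: Pv P0.
Qed.

Lemma card_flags : #|F| = (nedges G * 2)%N.
Proof.
rewrite /nedges (fcard_order_set (can_inj oflagK)) //.
apply/fintype.subsetP => f _; rewrite inE /order; apply/eqP.
transitivity #|pred2 f (o f)|; last by rewrite card2 eq_sym oflag_neq.
apply: eq_card => g; rewrite !inE; apply/idP/orP.
  move=> /(fconnect_closed (P := pred2 f (o f))) H; apply/orP/H; last by rewrite /= eqxx.
  by move=> z /orP[] /eqP -> /=; rewrite ?oflagK eqxx ?orbT.
by case=> /eqP ->; rewrite ?connect0 ?fconnect1.
Qed.

Lemma valence_gt1 u : (1 < valence G u)%N = [exists f, (v f == u) && (s f != f)].
Proof.
apply/card_gt1P/existsP => [[f [g [/eqP fu /eqP gu fg]]]|[f /andP[/eqP fu sf]]].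
  exists f; rewrite fu eqxx /=; apply: contra fg => /eqP sf.
  have : fconnect s f g by rewrite fconnect_csucc fu gu.
  move=> /(fconnect_closed (P := pred1 f)) H; rewrite eq_sym; apply: H => /=.
    by move=> z /eqP->; rewrite sf.
  exact: eqxx.
by exists f, (s f); rewrite !inE vert_csucc fu eq_sym sf.
Qed.

End Ribbon.

(** * Plane trees: edge cuts and the boundary walk *)

Section TreeGraph.
Context {V F : finType}.
Variable G : graph V F.
Hypotheses (ribG : is_ribbon G) (cardG : #|V| = (nedges G).+1).
Local Notation v := (vert G).
Local Notation o := (oflag G).
Local Notation s := (csucc G).
Local Notation N := (cnext G).

(* Breadth-first search from r: par u is the first flag of a shortest path from
   u to r. *)
Lemma parent_exists (f0 : F) (r : V) : exists (d : V -> nat) (par : V -> F),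
  forall u, u != r -> v (par u) = u /\ (d (v (o (par u))) < d u)%N.
Proof.
pose D u m := [exists p : m.-tuple V, path (adjacency G) r p && (last r p == u)].
have exD u : exists m, D u m.
  have [_ _ _ _ /(_ r u) /connectP[p rp ->]] := ribG.
  by exists (size p); apply/existsP; exists (in_tuple p); rewrite rp eqxx.
pose d u := ex_minn (exD u); exists d.
suff /choice[par parP] : forall u, exists f, u != r -> v f = u /\ (d (v (o f)) < d u)%N.
  by exists par.
move=> u; case: (eqVneq u r) => [_|ur]; first by exists f0.
rewrite {2}/d; case: ex_minnP => m /existsP[p /andP[rp pu]] _.
case: (lastP (val p)) (size_tuple p) rp pu => [_ _ /= /eqP ru|p' w].
  by rewrite ru eqxx in ur.
rewrite size_rcons rcons_path last_rcons => <- /andP[rp' /existsP[f]].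
move=> /andP[/eqP fl /eqP fw] /eqP wu; exists (o f) => _.
rewrite (oflagK ribG) fw wu fl; split=> //.
rewrite /d; case: ex_minnP => m' _; rewrite ltnS; apply.
by apply/existsP; exists (in_tuple p'); rewrite rp' eqxx.
Qed.

(** The parent edges for the root [v f] are distinct and as many as all edges, so [f] lies on the
    parent edge of some [w]; one side of the cut consists of the descendants of [w]. *)
Lemma edge_cut f : exists S : pred V, [/\ ~~ S (v f), S (v (o f)) &
  forall g, g != f -> g != o f -> S (v g) = S (v (o g))].
Proof.
pose r := v f; have [d [par parP]] := parent_exists f r.
have oK := oflagK ribG; have sumC := fconnect_sym (can_inj oK).
have edgeP g h : froot o g = froot o h -> g = h \/ g = o h.
  move=> /(fingraph.rootP sumC)/(fconnect_closed (P := pred2 g (o g))) H.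
  have /orP[/eqP->|/eqP->] : pred2 g (o g) h; [apply: H| |].
  - by move=> z /orP[] /eqP->; rewrite /= ?oK eqxx ?orbT.
  - by rewrite /= eqxx.
  - by left.
  - by right; rewrite oK.
pose A := [pred u | u != r].
(* Two vertices with the same parent edge would be each other's parents, against the decrease of
   [d]. *)
have parI : {in A &, injective (fun u => froot o (par u))}.
  move=> u u'; rewrite !inE => ur u'r /edgeP.
  have [pu du] := parP _ ur; have [pu' du'] := parP _ u'r.
  case=> E; first by rewrite -pu -pu' E.
  move: du du'; rewrite E oK pu' -{1}pu E => /ltn_trans h /h; by rewrite ltnn.
have cA : #|A| = nedges G.
  by move: cardG; rewrite (cardC1 r : #|A| = _) => ->.
(* There are [#|V| - 1] parent edges and, by [cardG], as many edges: every edge is a parent edge. *)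
have allP g : (exists2 u, u != r & g = par u \/ g = o (par u)).
  have cE : #|[seq froot o (par u) | u in A]| = #|froots o|.
    rewrite card_in_image // cA /nedges /n_comp_mem; apply: eq_card => z.
    by rewrite !inE andbT.
  suff /fintype.imageP[u ur gu] : froot o g \in [seq froot o (par u) | u in A].
    by exists u => //; exact: edgeP.
  rewrite (elimT (subset_cardP cE)); first exact: (roots_root sumC).
  apply/fintype.subsetP => z /fintype.imageP[u _ ->]; exact: (roots_root sumC).
pose pv u := if u == r then r else v (o (par u)).
pose desc w := fun u => fconnect pv u w.
have dpv u : (d (pv u) <= d u)%N.
  rewrite /pv; case: eqVneq => [->//|ur]; by have [_ /ltnW] := parP _ ur.
have ddesc w u : desc w u -> (d w <= d u)%N.
  move=> /(fconnect_closed (P := fun w => (d w <= d u)%N)); apply=> // z; exact: leq_trans.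
have [w wr fw] := allP f; have [pw dw] := parP _ wr.
have descW u : u != r -> u != w -> desc w u = desc w (v (o (par u))).
  move=> ur uw; have pvE : pv u = v (o (par u)) by rewrite /pv (negPf ur).
  rewrite /desc; apply/fconnect_iterP/idP => [[[|i]]|].
  - by move=> /= E; rewrite E eqxx in uw.
  - by rewrite iterSr pvE => <-; exact: fconnect_iter.
  - rewrite -pvE => h; apply/fconnect_iterP; exact: connect_trans (fconnect1 _ _) h.
(* Such an edge joins some [u] other than [w] to its parent, and these descend from [w] both or not
   at all. *)
have cross g : g != par w -> g != o (par w) -> desc w (v g) = desc w (v (o g)).
  have [u ur gu] := allP g => g1 g2; have [pu _] := parP _ ur.
  have uw : u != w.
    by apply: contraNneq g1 => uw; case: gu g2 => ->; rewrite uw ?eqxx.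
  by case: gu => ->; rewrite ?oK pu (descW u).
have dwT : desc w (v (par w)) by rewrite pw /desc connect0.
have dwF : ~~ desc w (v (o (par w))).
  by apply/negP => /ddesc; rewrite leqNgt dw.
case: fw => fE.
  exists (fun u => ~~ desc w u); rewrite fE dwT dwF; split=> // g g1 g2.
  by rewrite cross.
by exists (desc w); rewrite fE oK dwT dwF; split=> // g g1 g2; exact: cross.
Qed.

(** A second edge with the same ends would cross the cut made by [f]; and [g = oflag f] would make
    [f] a loop, whereas the cut separates its ends. *)
Lemma single_edge f g : v f = v g -> v (o f) = v (o g) -> f = g.
Proof.
move=> fg ofg; have [S [Sf So Sg]] := edge_cut f.
apply/esym/eqP; apply: contraT => gf; have := Sg g gf.
case: eqVneq => [gE|_ /(_ isT)]; last by rewrite -fg -ofg So (negPf Sf).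
by move: Sf; rewrite fg gE So.
Qed.

(* From f, the boundary walk stays in the part of the tree beyond the edge of f
   until it comes back through that edge. *)
Lemma first_return f : exists j, iter j.+1 N f = s f /\
  forall i, (0 < i <= j)%N -> v (iter i N f) != v f.
Proof.
have [S [Sf So Sg]] := edge_cut f; have oK := oflagK ribG.
have vN g : v (N g) = v (o g) by rewrite /cnext (vert_csucc ribG).
(* [o f] is the only flag through which the walk can leave [S]. *)
have step i : (forall k, (0 < k <= i)%N -> iter k N f != o f) ->
    forall k, (0 < k <= i.+1)%N -> S (v (iter k N f)).
  move=> ne; elim=> [//|k IH] /=; rewrite ltnS => ki; rewrite vN.
  case: k IH ki => [|k] IH ki; [exact: So|rewrite -Sg].
  - by apply: IH; exact: ltnW.
  - by apply/eqP => E; have /(_ (ltnW ki)) := IH; rewrite E (negPf Sf).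
  - exact: ne.
have jex : exists j, (0 < j)%N && (iter j N f == o f).
  apply: contrapT => /forallNP nex.
  have ne k : (0 < k)%N -> iter k N f != o f.
    by move=> k0; apply/negP => kf; apply: (nex k); rewrite k0 kf.
  (* Otherwise the walk would still be in [S] after [order N f] steps, when it is back at [f],
     outside [S]. *)
  have := step (order N f) (fun k => fun h => ne k (proj1 (andP h))) (order N f).
  by rewrite order_gt0 leqnSn iter_order ?(negPf Sf) => [/(_ isT)|]//; exact: cnext_inj.
case: (ex_minnP jex) => j /andP[j0 /eqP jf] jmin.
exists j; split=> [|i /andP[i0 ij]]; first by rewrite iterS jf /cnext oK.
have Si : S (v (iter i N f)).
  case: j j0 jf jmin ij => // j _ jf jmin ij; apply: (step j); last by rewrite i0.
  by move=> k /andP[k0 kj]; apply/negP => kf; have := jmin k; rewrite k0 kf ltnNge kj => /(_ isT).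
by apply: contraTneq Si => ->.
Qed.

(** The cycle of [f] is closed under [csucc] by [first_return]. It is closed under [oflag] because a
    walk that has crossed the edge of [g] must come back to [g], and can do so only through
    [oflag g]. *)
Lemma tree_one_cycle f g : fconnect N f g.
Proof.
have NI := cnext_inj ribG.
apply: (flag_ind ribG (P := fconnect N f) (connect0 _ f)) => {}g fg.
  have [S [Sg So Scross]] := edge_cut g.
  rewrite (same_connect (fconnect_sym NI) fg) => {fg}.
  apply: contraT => ng.
  have : fconnect N (N g) g by rewrite -same_fconnect1 // connect0.
  have P0 : fconnect N g (N g) && S (v (N g)).
    by rewrite fconnect1 /cnext (vert_csucc ribG) So.
  move/(fconnect_closed (P := fun z => fconnect N g z && S (v z))) => H.
  have /andP[_] : fconnect N g g && S (v g); last by rewrite (negPf Sg).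
  apply: H => // z /andP[gz Sz]; rewrite -same_fconnect1_r // gz.
  rewrite /cnext (vert_csucc ribG) -Scross //.
    by apply: contraTneq Sz => ->.
  by apply: contraNneq ng => <-.
have [j [<- _]] := first_return g.
exact: connect_trans fg (fconnect_iter _ _ _).
Qed.

End TreeGraph.

(** * Isomorphisms *)

Lemma flag_at (V F : finType) (G : graph V F) (f0 : F) u :
  is_ribbon G -> exists f, vert G f = u.
Proof.
move=> [_ _ _ _ /(_ (vert G f0) u) /connectP[p]].
case: (lastP p) => [_ ->|p' w]; first by exists f0.
rewrite rcons_path last_rcons => /andP[_ /existsP[f /andP[_ /eqP fw]]] ->.
by exists (oflag G f).
Qed.

Section Isomorphisms.
Context {V F V' F' : finType}.
Implicit Type G : graph V F.

(** Vertices are the orbits of [csucc], so a bijection of flags respecting the structure maps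
    induces one of vertices. *)
Lemma graph_iso_of_flags G (G' : graph V' F') (f0 : F) (q : F -> F') :
  is_ribbon G -> is_ribbon G' -> bijective q ->
  (forall f, oflag G' (q f) = q (oflag G f)) ->
  (forall f, csucc G' (q f) = q (csucc G f)) ->
  exists p, graph_iso G G' p q.
Proof.
move=> rG rG' bq qo qs; have [q' qK q'K] := bq.
have /choice[ft ftP] := fun u => flag_at f0 u rG.
have /choice[ft' ft'P] := fun u => flag_at (q f0) u rG'.
have qv f g : vert G f = vert G g <-> vert G' (q f) = vert G' (q g).
  split=> /eqP; rewrite -fconnect_csucc // => h; apply/eqP; move: h;
  by rewrite -fconnect_csucc // (fconnect_morph _ _ (can_inj qK) qs).
exists (fun u => vert G' (q (ft u))); split=> // [|f]; last exact/qv.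
exists (fun u => vert G (q' (ft' u))) => u.
  by rewrite -[RHS]ftP; apply/qv; rewrite q'K ft'P.
by rewrite -[RHS]ft'P -[ft' u in RHS]q'K; apply/qv; rewrite ftP.
Qed.

Variables (G : graph V F) (G' : graph V' F') (p : V -> V') (q : F -> F').
Hypothesis iso : graph_iso G G' p q.

Lemma vert_iso f : vert G' (q f) = p (vert G f). Proof. by case: iso. Qed.
Lemma oflag_iso f : oflag G' (q f) = q (oflag G f). Proof. by case: iso. Qed.
Lemma csucc_iso f : csucc G' (q f) = q (csucc G f). Proof. by case: iso. Qed.

Lemma cnext_iso f : cnext G' (q f) = q (cnext G f).
Proof. by rewrite /cnext oflag_iso csucc_iso. Qed.

Lemma fconnect_cnext_iso f f' :
  fconnect (cnext G') (q f) (q f') = fconnect (cnext G) f f'.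
Proof. by case: iso => _ /bij_inj qI _ _ _; apply: fconnect_morph => // ?; exact: cnext_iso. Qed.

Lemma is_ribbon_iso : is_ribbon G -> is_ribbon G'.
Proof.
move=> rG; have [oK oN sI sC con] := rG.
have [[p' pK p'K] [q' qK q'K] _ _ _] := iso; split.
- by move=> f; rewrite -(q'K f) !oflag_iso oK.
- by move=> f; rewrite -(q'K f) oflag_iso (inj_eq (can_inj qK)).
- by move=> f f'; rewrite -(q'K f) -(q'K f') !csucc_iso => /(can_inj qK)/sI ->.
- move=> f f'; rewrite -(q'K f) -(q'K f') (fconnect_morph _ _ (can_inj qK) csucc_iso).
  by rewrite sC !vert_iso (inj_eq (can_inj pK)).
- move=> u w; rewrite -(p'K u) -(p'K w).
  have /connectP[r] := con (p' u) (p' w); elim: r (p' u) => [|z r IH] x /=.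
    by move=> _ ->; exact: connect0.
  move=> /andP[/existsP[f /andP[/eqP fx /eqP fz]] zr] /(IH _ zr).
  apply: connect_trans; apply/connect1/existsP; exists (q f).
  by rewrite oflag_iso !vert_iso fx fz !eqxx.
Qed.

Lemma valence_iso u : valence G' (p u) = valence G u.
Proof.
have [/bij_inj pI bq _ _ _] := iso; have [q' qK q'K] := bq.
rewrite /valence -(fintype.card_image (can_inj qK)); apply: eq_card => f.
by rewrite -(q'K f) fintype.mem_image ?inE; [rewrite vert_iso (inj_eq pI)|exact: can_inj qK].
Qed.

Lemma nedges_iso : is_ribbon G -> nedges G' = nedges G.
Proof.
move=> rG; apply/eqP; rewrite -(eqn_pmul2r (isT : 0 < 2)%N).
rewrite -!card_flags //; last exact: is_ribbon_iso.
by have [_ bq _ _ _] := iso; rewrite (bij_eq_card bq).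
Qed.

End Isomorphisms.

Lemma ncycles_labelled (V F : finType) (G : graph V F) m (lab : F -> 'I_m) :
  is_ribbon G -> (forall f f', fconnect (cnext G) f f' = (lab f == lab f')) ->
  (forall i, exists f, lab f = i) -> ncycles G = m.
Proof.
move=> rG labP lab_surj; have sC := fconnect_sym (cnext_inj rG).
have -> : ncycles G = #|froots (cnext G)|.
  by rewrite /ncycles /n_comp_mem; apply: eq_card => z; rewrite !inE andbT.
rewrite -[RHS]card_ord -(card_in_image (f := lab) (A := froots (cnext G))).
  apply: eq_card => i; rewrite [RHS]inE; have [f <-] := lab_surj i.
  apply/fintype.imageP; exists (froot (cnext G) f); first exact: roots_root.
  by apply/eqP; rewrite -labP connect_root.
move=> f g fr gr /eqP; rewrite -labP -root_connect //.
by move: fr gr; rewrite !inE /roots => /eqP-> /eqP-> /eqP.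
Qed.

Section TreeIsomorphisms.
Context {n : nat} {V F : finType}.
Implicit Type t : tree_data n V F.

Lemma tree_iso_sym (V' F' : finType) t (t' : tree_data n V' F') p q :
  tree_iso t t' p q -> exists p' q',
    [/\ cancel p p', cancel p' p, cancel q q', cancel q' q & tree_iso t' t p' q'].
Proof.
move=> [isoG tc tr]; have [p' [q' [pK p'K qK q'K isoG']]] := graph_iso_sym isoG.
by exists p', q'; split=> //; split=> // [v|]; rewrite ?tr ?pK // -tc p'K.
Qed.

Lemma tree_iso_trans (V1 F1 V2 F2 : finType) t (t1 : tree_data n V1 F1)
    (t2 : tree_data n V2 F2) p q p1 q1 :
  tree_iso t t1 p q -> tree_iso t1 t2 p1 q1 ->
  tree_iso t t2 (p1 \o p) (q1 \o q).
Proof.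
move=> [iso1 c1 r1] [iso2 c2 r2]; split; first exact: graph_iso_trans iso1 iso2.
  by move=> v /=; rewrite c2 c1.
by rewrite r2 r1.
Qed.

Lemma white_iso (V' F' : finType) t (t' : tree_data n V' F') p q v :
  tree_iso t t' p q -> white t' (p v) = white t v.
Proof. by case=> _ tc _; rewrite /white tc. Qed.

Lemma is_tree_iso (V' F' : finType) t (t' : tree_data n V' F') p q :
  tree_iso t t' p q -> is_tree t -> is_tree t'.
Proof.
move=> isoT; have wh v := white_iso v isoT; have [iso tc tr] := isoT.
move=> [[rib cardV] lab [rootw root1 rootb] bip leaf].
have rib' := is_ribbon_iso iso rib.
have [[p' pK p'K] [q' qK q'K] pv po _] := iso; have pI := can_inj pK.
split=> //.
- by split=> //; rewrite (nedges_iso iso rib) -cardV; apply/esym/bij_eq_card; exists p'.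
- move=> i; have [v [vi vU]] := lab i; exists (p v); split=> [|w]; first by rewrite tc.
  by rewrite -(p'K w) tc => /vU ->.
- rewrite tr wh (valence_iso iso); split=> // f; rewrite -(q'K f) pv => /pI/rootb.
  by rewrite po pv wh.
- move=> f; rewrite -(q'K f) po !pv tr !(inj_eq pI) !wh; exact: bip.
- by move=> v; rewrite -(p'K v) tr (inj_eq pI) /arity (valence_iso iso) wh; exact: leaf.
Qed.

Lemma ord_tree_exists t : is_tree t ->
  exists (t' : ord_tree n) p q, tree_iso t t' p q.
Proof.
move=> tT; pose t' : tree_data n 'I_#|V| 'I_#|F| := TreeData
  (Graph (fun f => enum_rank (vert t (enum_val f)))
    (fun f => enum_rank (oflag t (enum_val f)))
    (fun f => enum_rank (csucc t (enum_val f))))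
  (fun v => tcol t (enum_val v)) (enum_rank (troot t)).
have iso : tree_iso t t' enum_rank enum_rank.
  split=> //; last by move=> v /=; rewrite enum_rankK.
  by split=> [||f|f|f] /=; rewrite ?enum_rankK //; exact: enum_rank_bij.
by exists (OrdTree (is_tree_iso iso tT)), enum_rank, enum_rank.
Qed.

End TreeIsomorphisms.

Section CactusIsomorphisms.
Context {R : realType} {n : nat} {V F : finType}.
Implicit Type c : cactus_data R n V F.

Lemma cactus_iso_trans (V1 F1 V2 F2 : finType) c (c1 : cactus_data R n V1 F1)
    (c2 : cactus_data R n V2 F2) p q p1 q1 :
  cactus_iso c c1 p q -> cactus_iso c1 c2 p1 q1 ->
  cactus_iso c c2 (p1 \o p) (q1 \o q).
Proof.
move=> [i1 b1 l1 e1] [i2 b2 l2 e2]; split; first exact: graph_iso_trans i1 i2.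
- by rewrite b2 b1.
- by move=> f /=; rewrite l2 l1.
- by move=> f /=; rewrite e2 e1.
Qed.

Lemma outer_iso (V' F' : finType) c (c' : cactus_data R n V' F') p q f :
  graph_iso c c' p q -> cbase c' = q (cbase c) -> outer c' (q f) = outer c f.
Proof. by move=> iso b; rewrite /outer b (fconnect_cnext_iso iso). Qed.

Lemma is_cactus_iso (V' F' : finType) c (c' : cactus_data R n V' F') p q :
  cactus_iso c c' p q -> is_cactus c -> is_cactus c'.
Proof.
move=> [iso cb cl ce] [[[rib gen] outP val0 valP] [labP labS] labb [lenO len0]].
have rib' := is_ribbon_iso iso rib.
have [bp [q' qK q'K] pv po _] := iso; have [p' pK p'K] := bp; have pI := can_inj pK.
have labP' f f' : fconnect (cnext c') f f' = (clab c' f == clab c' f').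
  by rewrite -(q'K f) -(q'K f') (fconnect_cnext_iso iso) !cl labP.
have labS' i : exists f, clab c' f = i.
  by have [f fi] := labS i; exists (q f); rewrite cl.
split=> //.
- split; last 1 first.
  + move=> v; rewrite -(p'K v) cb pv (inj_eq pI) (valence_iso iso); exact: valP.
  + split=> //; rewrite /genus0 (nedges_iso iso rib) -(bij_eq_card bp) -gen.
    by rewrite (ncycles_labelled rib' labP' labS') (ncycles_labelled rib labP labS).
  + by move=> f; rewrite -(q'K f) po !(outer_iso _ iso cb).
  + by rewrite cb pv (valence_iso iso).
- by rewrite cb cl.
- by split=> f; rewrite -(q'K f) ?po !ce.
Qed.

Lemma ord_cactus_exists c : is_cactus c ->
  exists (c' : ord_cactus R n) p q, cactus_iso c c' p q.
Proof.
move=> cC; pose c' : cactus_data R n 'I_#|V| 'I_#|F| := CactusData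
  (Graph (fun f => enum_rank (vert c (enum_val f)))
    (fun f => enum_rank (oflag c (enum_val f)))
    (fun f => enum_rank (csucc c (enum_val f))))
  (enum_rank (cbase c)) (fun f => clab c (enum_val f)) (fun f => clen c (enum_val f)).
have iso : cactus_iso c c' enum_rank enum_rank.
  split=> [|//|f|f] /=; rewrite ?enum_rankK //.
  by split=> [||f|f|f] /=; rewrite ?enum_rankK //; exact: enum_rank_bij.
by exists (OrdCactus (is_cactus_iso iso cC)), enum_rank, enum_rank.
Qed.

End CactusIsomorphisms.

(** * The boundary walk of a planted tree *)

Lemma eq_in_fconnect (T : finType) (P : pred T) (s d : T -> T) x y :
  (forall z, P z -> P (s z)) -> (forall z, P z -> d z = s z) -> P x ->
  fconnect d x y = fconnect s x y.
Proof.
move=> Ps ds Px; have it i : iter i d x = iter i s x /\ P (iter i s x).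
  by elim: i => //= i [-> Pi]; rewrite ds //; split=> //; exact: Ps.
apply/fconnect_iterP/fconnect_iterP => -[i <-]; exists i;
  by have [] := it i.
Qed.

(** The hypothesis makes reachability symmetric: [x] is reached from [s x], hence has a preimage,
    and a surjection of a finite type is injective. The injectivity clause of [is_ribbon] thus
    follows from the one on fibres. *)
Lemma fconnect_fibres_inj (T : finType) (U : eqType) (s : T -> T) (h : T -> U) :
  (forall x y, fconnect s x y = (h x == h y)) -> injective s.
Proof.
move=> sh; have /choice[g gK] : forall x, exists y, s y = x.
  move=> x; have : fconnect s (s x) x by rewrite sh eq_sym -sh fconnect1.
  by move=> /fconnect_iterP[i <-]; exists (iter i s x); rewrite -iterSr.
by have /can_inj := canF_sym gK.
Qed.

Lemma path_sub_mem (T : eqType) (e e' : rel T) x p :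
  (forall u y, y \in p -> e u y -> e' u y) -> path e x p -> path e' x p.
Proof.
elim: p x => //= y p IH x sub /andP[xy yp]; rewrite sub ?mem_head //=.
by apply: IH yp => u z zp; apply: sub; rewrite inE zp orbT.
Qed.

Lemma valence_gt1_neq (V F : finType) (G : graph V F) f : is_ribbon G ->
  (1 < valence G (vert G f))%N -> csucc G f != f.
Proof.
move=> rG; rewrite valence_gt1 // => /existsP[g /andP[/eqP gf]].
apply: contraNneq => sf.
have : fconnect (csucc G) f g by rewrite fconnect_csucc // gf.
move=> /(fconnect_closed (P := pred1 f)) /= H.
have /eqP-> : g == f by apply: H => // z /eqP->; rewrite sf.
by rewrite sf.
Qed.

(* The root vertex, a leaf, behaves like one more white vertex: with it, every
   edge of a tree has exactly one end satisfying wr. *)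
Definition wr (n : nat) (V F : finType) (t : tree_data n V F) (f : F) : bool :=
  white t (vert t f) || (vert t f == troot t).

(* From a flag at a white vertex, or the root flag, to the next such flag on the
   boundary walk. *)
Definition walk (V F : finType) (G : graph V F) (f : F) : F := cnext G (cnext G f).

Section Tree.
Context {n : nat} {V F : finType}.
Variable t : tree_data n V F.
Hypothesis treeT : is_tree t.
Local Notation v := (vert t).
Local Notation o := (oflag t).
Local Notation s := (csucc t).
Local Notation N := (cnext t).
Local Notation M := (walk t).

Lemma tree_ribbon : is_ribbon t. Proof. by case: treeT => -[]. Qed.
Lemma tree_card : #|V| = (nedges t).+1. Proof. by case: treeT => -[]. Qed.
Let rib := tree_ribbon.
Let oK := oflagK rib.
Let sI := csucc_inj rib.
Let vs := vert_csucc rib.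

Lemma root_flag_exists : exists r, v r = troot t.
Proof.
have [_ _ [_ /eqP/fintype.card1P[r rP] _] _ _] := treeT.
by exists r; have := rP r; rewrite !inE eqxx => /eqP.
Qed.

Lemma root_flag_uniq f g : v f = troot t -> v g = troot t -> f = g.
Proof.
have [_ _ [_ /eqP/fintype.card1P[r rP] _] _ _] := treeT.
move=> /eqP fr /eqP gr; have := rP f; have := rP g.
by rewrite !inE fr gr => /esym/eqP-> /esym/eqP->.
Qed.

Lemma root_black : ~~ white t (troot t).
Proof. by have [_ _ []] := treeT. Qed.

Lemma oflag_root f : v f = troot t -> v (o f) != troot t.
Proof.
move=> fr; apply/eqP => ofr; have := oflag_neq rib f.
by rewrite (root_flag_uniq ofr fr) eqxx.
Qed.

Lemma wr_oflag f : wr t (o f) = ~~ wr t f.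
Proof.
have [_ _ [_ _ rootb] bip _] := treeT; rewrite /wr.
case: (eqVneq (v f) (troot t)) => [fr|fr].
  by rewrite orbT (negPf (rootb _ fr)) (negPf (oflag_root fr)).
case: (eqVneq (v (o f)) (troot t)) => [ofr|ofr].
  by have := rootb _ ofr; rewrite oK orbF orbT => ->.
by have := bip _ fr ofr; rewrite !orbF; do 2!case: white.
Qed.

Lemma wr_csucc f : wr t (s f) = wr t f.
Proof. by rewrite /wr vs. Qed.

Lemma wr_cnext f : wr t (N f) = ~~ wr t f.
Proof. by rewrite wr_csucc wr_oflag. Qed.

Lemma wr_walk f : wr t (M f) = wr t f.
Proof. by rewrite !wr_cnext negbK. Qed.

Lemma walk_inj : injective M.
Proof. by move=> f g /(cnext_inj rib)/(cnext_inj rib). Qed.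

Lemma iter_walk i f : iter i M f = iter i.*2 N f.
Proof. by elim: i => //= i ->. Qed.

Lemma wr_iter_cnext i f : wr t (iter i N f) = odd i (+) wr t f.
Proof. by elim: i => //= i IH; rewrite wr_cnext IH addNb. Qed.

(** [cnext] forms one cycle and changes [wr] at each step, so flags with the same [wr] are an even
    number of steps apart. *)
Lemma fconnect_walk f g : wr t f = wr t g -> fconnect M f g.
Proof.
move=> fg; have /fconnect_iterP[i iE] := tree_one_cycle rib tree_card f g.
have := wr_iter_cnext i f; rewrite iE -fg; case: (boolP (odd i)) => [_|ev _].
  by case: (wr t f).
apply/fconnect_iterP; exists i./2; rewrite iter_walk even_halfK //.
Qed.

(** [csucc t f] has the same [wr] as [f], so the return time of [first_return] is even and can be
    halved. *)
Lemma walk_first_return f : exists j, iter j.+1 M f = s f /\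
  forall i, (0 < i <= j)%N -> v (iter i M f) != v f.
Proof.
have [j [jE jmin]] := first_return rib tree_card f.
have := wr_iter_cnext j.+1 f; rewrite jE wr_csucc.
case: (boolP (odd j.+1)) => [_|ev _]; first by case: (wr t f).
case: j jE jmin ev => // j jE jmin ev.
have jj : (j./2.+1).*2 = j.+2 by rewrite doubleS even_halfK //=; move: ev; rewrite /= negbK.
exists j./2; rewrite iter_walk jj; split=> // i /andP[i0 ij].
rewrite iter_walk; apply: jmin; rewrite double_gt0 i0 /=.
have : (i.*2 <= (j./2).*2)%N by rewrite leq_double.
move=> /leq_trans; apply; apply: leq_trans (leqnSn j).
by rewrite -[X in (_ <= X)%N]odd_double_half leq_addl.
Qed.

Lemma black_succ_neq f : ~~ wr t f -> s f != f.
Proof.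
rewrite /wr negb_or => /andP[fw fr]; apply: valence_gt1_neq => //.
have [_ _ _ _ leaf] := treeT; rewrite ltnNge; apply: contra fw => le1.
by apply: leaf => //; apply/eqP; rewrite /arity -leqn0 -ltnS; case: valence le1.
Qed.

Lemma white_label u w : white t u -> tcol t u = tcol t w -> u = w.
Proof.
rewrite /white; case E : (tcol t u) => [i|//] _ /esym iw.
have [_ lab _ _ _] := treeT; have [x [_ xU]] := lab i.
by rewrite -(xU _ E) -(xU _ iw).
Qed.

Lemma white_wr f : white t (v f) -> wr t f. Proof. by rewrite /wr => ->. Qed.

Lemma wr_white f r : v r = troot t -> wr t f -> f != r -> white t (v f).
Proof.
move=> rr /orP[//|/eqP fr]; rewrite (root_flag_uniq fr rr) eqxx //.
Qed.

(** * Cyclic orders and boundary walk after a collapse *)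

Section DegenSucc.
Variable h : F.
Hypotheses (hw : white t (v h)) (h1 : (1 <= arity t (v h))%N).
Local Notation hm := (finv s h).
Local Notation k := (o h).
Local Notation km := (o (finv s h)).

Let shm : s hm = h. Proof. exact: f_finv. Qed.

Let hmh : hm != h.
Proof.
apply: contraTneq (valence_gt1_neq (f := h) rib _) => [E|]; first by rewrite -{1}E shm eqxx.
by move: h1; rewrite /arity; case: valence => [//|[]].
Qed.

Let wh : wr t h. Proof. exact: white_wr. Qed.
Let whm : wr t hm. Proof. by rewrite -wr_csucc shm. Qed.
Let wk : ~~ wr t k. Proof. by rewrite wr_oflag negbK. Qed.
Let wkm : ~~ wr t km. Proof. by rewrite wr_oflag negbK. Qed.

(** Otherwise [h] and its predecessor, distinct because the arity is at least 1, would be two edges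
    with the same ends. *)
Lemma degen_ends_neq : v k != v km.
Proof.
apply: contra hmh => /eqP kkm; apply/eqP/(single_edge rib tree_card) => //.
by rewrite -vs shm.
Qed.

(** The merged order in closed form: the last flag of [(km, A)], formerly followed by [km], now
    leads to the first flag [s k] of [B]; the last flag of [B], formerly followed by [k], leads back
    to [km]. *)
Let bsucc g := if s g == km then s k else if s g == k then km else s g.

Lemma merged_cycle : fcycle bsucc (merged_order t h) /\ uniq (merged_order t h).
Proof.
have kkm : k != km by apply: contraNneq degen_ends_neq => ->.
have [A oA] : exists A, orbit s km = km :: A.
  by rewrite /orbit -orderSpred; eexists.
have [B oB] : exists B, orbit s k = k :: B.
  by rewrite /orbit -orderSpred; eexists.
have := orbit_uniq s km; have := orbit_uniq s k.
rewrite oA oB /= => /andP[kB uB] /andP[kmA uA].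
have vA g : g \in km :: A -> v g = v km.
  by rewrite -oA -fconnect_orbit fconnect_csucc // => /eqP.
have vB g : g \in k :: B -> v g = v k.
  by rewrite -oB -fconnect_orbit fconnect_csucc // => /eqP.
have kA : k \notin A.
  by apply/negP => kA; move: degen_ends_neq; rewrite (vA k) ?eqxx // inE kA orbT.
have kmB : km \notin B.
  by apply/negP => kB'; move: degen_ends_neq; rewrite -(vB km) ?eqxx // inE kB' orbT.
have AB : ~~ has [in A] B.
  apply/hasPn => g gB; apply/negP => gA; move: degen_ends_neq.
  by rewrite -(vA g) ?inE ?gA ?orbT // (vB g) ?eqxx // inE gB orbT.
rewrite /merged_order oA oB /=; split; last first.
  by rewrite cat_uniq mem_cat negb_or kmA kmB uA uB AB.
have := cycle_orbit sI km; have := cycle_orbit sI k; rewrite oA oB /=.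
have agree (C : seq F) x : km \notin C -> k \notin C -> path (frel s) x C -> path (frel bsucc) x C.
  move=> kmC kC; apply: path_sub_mem => u y yC /eqP uy /=; rewrite /bsucc uy.
  case: (eqVneq y km) => [E|_]; first by rewrite E (negPf kmC) in yC.
  by case: (eqVneq y k) => [E|_]; first by rewrite E (negPf kC) in yC.
rewrite !rcons_path cat_path last_cat.
(* [B] is not empty, since a black vertex other than the root is not a leaf. *)
case: B oB kB uB vB kmB AB => [|y B] oB kB uB vB kmB AB /=.
  by move=> /eqP E; have := black_succ_neq wk; rewrite E eqxx.
move: kB kmB; rewrite !inE !negb_or => /andP[ky kB] /andP[kmy kmB].
move=> /andP[/andP[/eqP sky pB] /eqP lB] /andP[pA /eqP lA].
rewrite (agree _ _ kmA kA pA) (agree _ _ kmB kB pB) /bsucc lA lB sky !eqxx.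
by rewrite (negPf kkm) eqxx.
Qed.

Lemma mem_merged f :
  (f \in merged_order t h) = ((v f == v k) || (v f == v km)) && (f != k).
Proof.
rewrite /merged_order mem_cat.
have -> : f \in behead (orbit s k) = (v f == v k) && (f != k).
  have := orbit_uniq s k; rewrite [v f == _]eq_sym -fconnect_csucc // fconnect_orbit.
  rewrite /orbit -orderSpred /= inE => /andP[kN _].
  by case: eqP => [->|_] /=; rewrite ?andbT // (negPf kN).
rewrite -fconnect_orbit fconnect_csucc // [v km == _]eq_sym.
case: (eqVneq f k) => [->|_]; last by rewrite !andbT orbC.
by rewrite (negPf degen_ends_neq) !andbF.
Qed.

Lemma degen_succ_black g : ~~ wr t g -> g != k ->
  degen_succ t h g = if s g == km then s k else if s g == k then km else s g.
Proof.
move=> gb gk; rewrite /degen_succ; case: ifPn => gm.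
  have [cyc uni] := merged_cycle.
  by have /= /eqP <- := next_cycle cyc gm.
rewrite mem_merged gk andbT negb_or in gm.
have /andP[gvk gvkm] := gm.
have sgN x : v g != v x -> s g != x by apply: contra => /eqP <-; rewrite vs.
rewrite !(negPf (sgN _ _)) //.
by apply: contraNneq gb => gh; rewrite /wr gh hw.
Qed.

Lemma degen_succ_wr g : wr t g -> degen_succ t h g = skip s h g.
Proof.
move=> gw; rewrite /degen_succ mem_merged /skip.
have gN x : ~~ wr t x -> (v g == v x) = false.
  by move=> xb; apply: contraNF xb => /eqP gx; rewrite /wr -gx.
by rewrite !gN //; case: eqP => // ->.
Qed.

(** A collapse only omits [h] from the boundary walk; the invariance of the word rests on this. *)
Lemma walk_degen f : wr t f -> f != h ->
  degen_succ t h (o (degen_succ t h (o f))) = skip M h f.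
Proof.
move=> fw fh; have ofb : ~~ wr t (o f) by rewrite wr_oflag negbK.
have ofk : o f != k by rewrite (inj_eq (can_inj oK)).
rewrite (degen_succ_black ofb ofk) /skip /walk /cnext.
have obw g : ~~ wr t g -> wr t (o g) by rewrite wr_oflag.
have sE x : s x = h -> x = hm by move=> xh; apply: sI; rewrite shm.
(* Here the walk from [f] reaches [h]; in the collapsed tree it goes straight to the flag that the
   walk reaches after [h]. *)
case: (eqVneq (s (o f)) km) => E1.
  have skb : ~~ wr t (s k) by rewrite wr_csucc.
  rewrite E1 oK shm eqxx degen_succ_wr ?obw // /skip ifN //.
  apply/eqP => /sE skhm; move: degen_ends_neq.
  by rewrite -vs -[s k]oK skhm eqxx.
(* Here the walk passes through [k] to [s h]; afterwards it passes through [km] and [hm], whose new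
   successor is again [s h]. *)
case: (eqVneq (s (o f)) k) => E2.
  rewrite E2 !oK degen_succ_wr // /skip shm eqxx ifN //.
  by apply/eqP => /sE hhm; move: hmh; rewrite -hhm eqxx.
rewrite degen_succ_wr ?obw ?wr_csucc // /skip.
have -> // : (s (o (s (o f))) == h) = false.
by apply/eqP => /sE E; move: E1; rewrite -E oK eqxx.
Qed.

End DegenSucc.
End Tree.

(** * The word of a point of a cell *)

Local Open Scope ring_scope.

(** Extension by 0 lets sums and words range over plain flags. The root flag gets length 0 and so
    drops out of the word. *)
Definition ext (R : realType) (n : nat) (V F : finType) (t : tree_data n V F)
    (x : wflag t -> R) (f : F) : R :=
  if insub f is Some e then x e else 0.

(* The labels and lengths of the arcs of positive length, in the order of the
   outer cycle. Contracting an arc of length 0 does not change this word. *)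
Definition word (R : realType) (n : nat) (V F : finType) (t : tree_data n V F)
    (x : wflag t -> R) (r : F) : seq (option 'I_n * R) :=
  [seq (tcol t (vert t f), ext x f) | f <- orbit (walk t) r & ext x f != 0].

Lemma orbit_map (T T' : finType) (q : T' -> T) (M' : T' -> T') (S : T -> T) r :
  injective q -> injective M' ->
  (forall f, fconnect M' r f -> q (M' f) = S (q f)) ->
  [seq q f | f <- orbit M' r] = orbit S (q r).
Proof.
move=> qI M'I qM; set p := map _ _.
have [l oE] : exists l, orbit M' r = r :: l by rewrite /orbit -orderSpred; eexists.
have pc : fcycle S p.
  rewrite /p cycle_map; have := cycle_orbit M'I r.
  apply: sub_in_cycle (allss _) => f g; rewrite -fconnect_orbit => rf _ /eqP <-.
  by rewrite /= qM.
rewrite (orbitE pc) ?(map_inj_uniq qI) ?orbit_uniq //.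
  by rewrite /p oE /= eqxx rot0.
by rewrite /p oE mem_head.
Qed.

Section Ext.
Context {R : realType} {n : nat} {V F : finType}.
Variables (t : tree_data n V F) (x : wflag t -> R).

Lemma ext_val e : ext x (val e) = x e.
Proof. by rewrite /ext valK. Qed.

Lemma ext_black f : ~~ white t (vert t f) -> ext x f = 0.
Proof. by move=> fb; rewrite /ext insubN. Qed.

Lemma ext_white f : white t (vert t f) -> exists2 e, val e = f & ext x f = x e.
Proof. by move=> fw; exists (Sub f fw); rewrite /ext ?insubT ?SubK. Qed.

Lemma sum_ext (P : pred F) :
  \sum_(e | P (val e)) x e = \sum_(f | P f) ext x f.
Proof.
rewrite [RHS](bigID (fun f => white t (vert t f))) /= [X in _ + X]big1 ?addr0; last first.
  by move=> f /andP[_ /ext_black].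
rewrite (reindex_omap (fun e : wflag t => val e) insub) /=.
  apply: eq_big => [e|e _]; last by rewrite ext_val.
  by rewrite valK eqxx andbT (valP e) andbT.
by move=> f /andP[_ fw]; rewrite insubT.
Qed.

End Ext.

Lemma sum_partial_inj (R : realType) (F F' : finType) (q : F' -> F) (P : pred F)
    (z : F -> R) : injective q ->
  (forall f, P f -> f \notin codom q -> z f = 0) ->
  \sum_(f' | P (q f')) z (q f') = \sum_(f | P f) z f.
Proof.
move=> qI z0; rewrite [RHS](bigID [in codom q]) /= [X in _ + X]big1 ?addr0; last first.
  by move=> f /andP[Pf fq]; exact: z0.
rewrite (reindex_omap q (fun f => [pick f' | q f' == f])) /=.
  apply: eq_bigl => f'; rewrite codom_f andbT; case: pickP => [g /eqP/qI->|/(_ f')].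
    by rewrite eqxx andbT.
  by rewrite eqxx.
move=> f /andP[_ /codomP[f' ->]]; case: pickP => [g /eqP/= <-//|/(_ f')].
by rewrite eqxx.
Qed.

(** * Invariance of lobe sums and of the word under a degeneration *)

Section Degenerations.
Context {n : nat} {V F V' F' : finType}.
Variables (t : tree_data n V F) (t' : tree_data n V' F') (h : F).
Variables (p : V -> V') (q : F' -> F).
Hypotheses (treeT : is_tree t) (treeT' : is_tree t').
Hypotheses (hw : white t (vert t h)) (h1 : (1 <= arity t (vert t h))%N).
Hypothesis deg : is_degeneration t h t' p q.
Local Notation v := (vert t).
Local Notation o := (oflag t).
Local Notation s := (csucc t).

Let qI : injective q. Proof. by case: deg => _ []. Qed.
Let codomE f : (f \in codom q) = (f != h) && (f != o h).
Proof. by have [_ [_ ->]] := deg. Qed.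
Let vq f : vert t' f = p (v (q f)). Proof. by case: deg. Qed.
Let col u : tcol t' (p u) = tcol t u. Proof. by have [_ _ _ _ [->]] := deg. Qed.

Lemma degen_white u : white t' (p u) = white t u.
Proof. by rewrite /white col. Qed.

Let oh_black : ~~ wr t (o h). Proof. by rewrite wr_oflag // negbK white_wr. Qed.
Let ohm_black : ~~ wr t (o (finv s h)).
Proof.
by rewrite wr_oflag // negbK /wr (vert_finv (tree_ribbon treeT)) hw.
Qed.

(** The only vertices identified are the two black ends of the collapsed angle, neither of them the
    root. *)
Lemma degen_vert_inj u w : white t u || (u == troot t) -> p u = p w -> u = w.
Proof.
move=> uw; have [[_ /(_ u w) [pE _]] _ _ _ _] := deg.
by case/pE => [//|[E _]|[E _]]; move: uw; rewrite E => E';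
  [move: oh_black|move: ohm_black]; rewrite /wr E'.
Qed.

Lemma degen_ext (R : realType) (x : wflag t -> R) (y : wflag t' -> R) f' :
  (forall (f' : wflag t') (f : wflag t), q (val f') = val f -> y f' = x f) -> ext y f' = ext x (q f').
Proof.
move=> xy; case: (boolP (white t' (vert t' f'))) => fw.
  have [e ef ->] := ext_white y fw.
  have [|e' e'f ->] := ext_white x (f := q f').
    by move: fw; rewrite vq degen_white.
  by apply: xy; rewrite ef e'f.
by rewrite !ext_black //; move: fw; rewrite vq degen_white.
Qed.

(** The flags missed by [q] are [h], of length 0, and its opposite, which is not at a white
    vertex. *)
Lemma degen_sum (R : realType) (x : wflag t -> R) (y : wflag t' -> R) u :
  ext x h = 0 ->
  (forall (f' : wflag t') (f : wflag t), q (val f') = val f -> y f' = x f) -> white t u ->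
  \sum_(e | vert t' (val e) == p u) y e = \sum_(e | v (val e) == u) x e.
Proof.
move=> xh xy uw; rewrite !(sum_ext _ (fun f => _ f == _)).
rewrite (eq_bigr _ (fun f' _ => degen_ext f' xy)).
rewrite -(sum_partial_inj (P := fun f => v f == u) qI).
  apply: eq_big => // f'; rewrite vq; apply/eqP/eqP => [/esym|->//].
  by move/(degen_vert_inj (u := u)) => ->; rewrite ?uw.
move=> f /eqP fu; rewrite codomE negb_and !negbK => /orP[/eqP->//|/eqP fk].
by move: oh_black; rewrite -fk /wr fu uw.
Qed.

Lemma degen_wr f' : wr t' f' = wr t (q f').
Proof.
rewrite /wr vq degen_white; congr (_ || _); have [_ _ _ _ [_ ->]] := deg.
apply/eqP/eqP => [/esym E|-> //]; apply/esym/degen_vert_inj => //.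
by rewrite eqxx orbT.
Qed.

Lemma degen_walk f' : wr t' f' -> q (walk t' f') = skip (walk t) h (q f').
Proof.
move=> fw; have [_ _ _ [qo qs] _] := deg.
have qfh : q f' != h.
  by have := codom_f q f'; rewrite codomE => /andP[].
rewrite -(walk_degen treeT hw h1) -?degen_wr // /walk /cnext.
by rewrite qs qo qs qo.
Qed.

Lemma degen_word (R : realType) (x : wflag t -> R) (y : wflag t' -> R) r r' :
  ext x h = 0 -> (forall (f' : wflag t') (f : wflag t), q (val f') = val f -> y f' = x f) ->
  v r = troot t -> vert t' r' = troot t' -> word y r' = word x r.
Proof.
move=> xh xy rr rr'.
have qr : q r' = r.
  apply: (root_flag_uniq treeT) => //; have [_ _ _ _ [_ tr]] := deg.
  apply/esym/degen_vert_inj; first by rewrite eqxx orbT.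
  by rewrite -vq rr' tr.
have rwr : wr t r by rewrite /wr rr eqxx orbT.
have rh : r != h by apply: contraTneq hw => <-; rewrite rr root_black.
have oE : [seq q f | f <- orbit (walk t') r'] = [seq f <- orbit (walk t) r | f != h].
  rewrite -orbit_skip //; last exact: walk_inj.
  rewrite -qr; apply: orbit_map => // [|f r'f]; first exact: walk_inj.
  apply: degen_walk; apply: (fconnect_closed (P := wr t')) r'f.
    by move=> g; rewrite wr_walk.
  by rewrite degen_wr qr.
(* [h] has length 0, so the word skipped it before it was deleted. *)
have fE : [seq f <- [seq f <- orbit (walk t) r | f != h] | ext x f != 0] =
    [seq f <- orbit (walk t) r | ext x f != 0].
  rewrite -filter_predI; apply: eq_filter => f /=.
  by case: (eqVneq f h) => [->|_]; rewrite ?xh ?eqxx ?andbT.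
rewrite /word -fE -oE filter_map -map_comp.
have yx f : (ext y f != 0) = preim q (fun f => ext x f != 0) f by rewrite /= (degen_ext _ xy).
rewrite (eq_filter yx).
by apply: eq_map => f /=; rewrite vq col (degen_ext _ xy).
Qed.

End Degenerations.

(** * Existence of degenerations *)

Section DegenerationExists.
Context {n : nat} {V F : finType}.
Variables (t : tree_data n V F) (h : F).
Hypothesis treeT : is_tree t.
Hypotheses (hw : white t (vert t h)) (h1 : (1 <= arity t (vert t h))%N).
Local Notation v := (vert t).
Local Notation o := (oflag t).
Local Notation s := (csucc t).
Local Notation hm := (finv s h).
Local Notation k := (o h).
Local Notation km := (o (finv s h)).
Local Notation d := (degen_succ t h).

Let rib := tree_ribbon treeT.
Let oK := oflagK rib.
Let sI := csucc_inj rib.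
Let vs := vert_csucc rib.

Let shm : s hm = h. Proof. exact: f_finv. Qed.
Let ends_neq := degen_ends_neq treeT h1.
Let wh : wr t h. Proof. exact: white_wr. Qed.
Let whm : wr t hm. Proof. by rewrite -(wr_csucc treeT) shm. Qed.
Let wk : ~~ wr t k. Proof. by rewrite wr_oflag // negbK. Qed.
Let wkm : ~~ wr t km. Proof. by rewrite wr_oflag // negbK. Qed.
Let hmh : hm != h. Proof. by apply: contraNneq ends_neq => ->. Qed.
Let hmk : hm != k. Proof. by apply: contraTneq whm => ->. Qed.
Let vwr f g : v f = v g -> wr t f = wr t g. Proof. by rewrite /wr => ->. Qed.

(** The merged vertex keeps the name of the end of [km], and the merged edge the flags [hm] and
    [km]; only [v k], [h] and [k] disappear. The default values in [toV] and [toF] below just make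
    these maps total. *)
Definition degenV := {u : V | u != v k}.
Definition degenF := {f : F | (f != h) && (f != k)}.
HB.instance Definition _ := Finite.on degenV.
HB.instance Definition _ := Finite.on degenF.

Let kmF : (hm != h) && (hm != k). Proof. by rewrite hmh hmk. Qed.
Let kmV : v km != v k. Proof. by rewrite eq_sym ends_neq. Qed.
Let toV (u : V) : degenV := insubd (exist _ (v km) kmV) u.
Let toF (f : F) : degenF := insubd (exist _ hm kmF) f.
Definition merge (u : V) : degenV := toV (if u == v k then v km else u).

Definition degen_tree : tree_data n degenV degenF := TreeData
  (Graph (fun f => merge (v (val f))) (fun f => toF (o (val f)))
    (fun f => toF (d (val f))))
  (fun u => tcol t (val u)) (merge (troot t)).

Let toFK f : (f != h) && (f != k) -> val (toF f) = f.
Proof. by move=> fF; rewrite val_insubd fF. Qed.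

Lemma val_merge u : val (merge u) = if u == v k then v km else u.
Proof. by rewrite val_insubd; case: (eqVneq u (v k)) => [_|->//]; rewrite kmV. Qed.

Lemma mergeE u w : (merge u == merge w) =
  ((if u == v k then v km else u) == (if w == v k then v km else w)).
Proof. by rewrite -val_eqE !val_merge. Qed.

Let oF f : (f != h) && (f != k) -> (o f != h) && (o f != k).
Proof.
move=> /andP[fh fk]; rewrite (inj_eq (can_inj oK)) fh andbT.
by apply: contraNneq fk => <-; rewrite oK.
Qed.

Let dF f : (f != h) && (f != k) -> (d f != h) && (d f != k).
Proof.
move=> /andP[fh fk]; case: (boolP (wr t f)) => fw.
  rewrite degen_succ_wr // skip_neq //=.
  have : wr t (skip s h f) by rewrite /skip; case: ifP; rewrite !wr_csucc.
  by apply: contraTneq => ->.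
have nh g : ~~ wr t g -> g != h by apply: contraNneq => ->.
have kmk : km != k by apply: contraNneq ends_neq => ->.
rewrite degen_succ_black //; case: (eqVneq (s f) km) => _.
  by rewrite nh ?wr_csucc // black_succ_neq.
case: (eqVneq (s f) k) => [_|sfk]; first by rewrite nh // kmk.
by rewrite sfk nh // wr_csucc.
Qed.

Lemma degen_tree_degen : is_degeneration t h degen_tree merge val.
Proof.
split.
- split=> [u|u w]; first by exists (val u); apply/val_inj; rewrite val_merge (negPf (valP u)).
  split=> [/eqP|]; rewrite ?mergeE.
    case: (eqVneq u (v k)) => [->|uk]; case: (eqVneq w (v k)) => [->|wk'] /eqP E.
    + by constructor 1.
    + by constructor 2; rewrite E.
    + by constructor 3.
    + by constructor 1.
  move=> E; apply/eqP; rewrite mergeE.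
  by case: E => [->|[-> ->]|[-> ->]]; rewrite ?eqxx ?(negPf kmV).
- split=> [|f]; first exact: val_inj.
  apply/codomP/idP => [[f' ->]|fF]; first exact: (valP f').
  by exists (toF f); rewrite toFK.
- by [].
- by split=> f' /=; rewrite toFK // ?oF ?dF ?(valP f').
- split=> // u /=; rewrite val_merge; case: eqP => // ->.
  have bl g : ~~ wr t g -> tcol t (v g) = None.
    by rewrite /wr negb_or => /andP[]; rewrite /white negbK => /eqP.
  by rewrite !bl.
Qed.

Let merged := merged_order t h.

Let fconnect_d_merged f f' : f \in merged -> fconnect d f f' = (f' \in merged).
Proof.
have [cyc uni] := merged_cycle treeT hw h1.
move=> fm; apply: fconnect_cycle fm _; have := cycle_next uni.
apply: sub_in_cycle (allss _) => g g' gm _ /eqP <-.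
by rewrite /= /degen_succ gm.
Qed.

(** There are three kinds of flags: on [wr] flags [d] is [skip s h]; at the merged vertex it runs
    through the single cycle [merged_order]; at the other black vertices it is [s]. *)
Lemma fconnect_degen f f' : (f != h) && (f != k) -> (f' != h) && (f' != k) ->
  fconnect d f f' = (merge (v f) == merge (v f')).
Proof.
move=> /andP[fh fk] /andP[f'h f'k]; rewrite mergeE.
have blk g : wr t f -> ~~ wr t g -> (v f == v g) = false.
  by move=> fw gw; apply: contraTF fw => /eqP/vwr ->.
case: (boolP (wr t f)) => fw.
  rewrite (eq_in_fconnect (P := wr t) (s := skip s h)) //.
  - rewrite fconnect_skip // fconnect_csucc // (blk _ fw wk).
    by case: (eqVneq (v f') (v k)) => [->|//]; rewrite !blk.
  - by move=> g gw; rewrite /skip; case: ifP; rewrite !wr_csucc.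
  - by move=> g gw; rewrite degen_succ_wr.
case: (boolP (f \in merged)) => fm.
  rewrite fconnect_d_merged //; move: fm; rewrite !mem_merged // fk f'k !andbT.
  move=> /orP[] /eqP ->; rewrite ?eqxx ?(negPf kmV);
    by case: (eqVneq (v f') (v k)) => _; rewrite /= ?eqxx 1?eq_sym.
move: fm; rewrite mem_merged // fk andbT negb_or => /andP[fvk fvkm].
rewrite (eq_in_fconnect (P := fun g => v g == v f) (s := s)) //; first last.
- move=> g /eqP gf; rewrite degen_succ_black //; first last.
  + by apply: contraNneq fvk => <-; rewrite gf.
  + by rewrite (vwr gf).
  rewrite !ifN //; [apply: contraNneq fvk|apply: contraNneq fvkm] => <-;
    by rewrite vs gf.
- by move=> g; rewrite vs.
rewrite fconnect_csucc // (negPf fvk).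
by case: (eqVneq (v f') (v k)) => [->|//]; rewrite (negPf fvk) (negPf fvkm).
Qed.

(** Connectedness is carried over by [merge], and the edge count survives because one vertex and one
    edge disappear. *)
Lemma degen_tree_is_tree : is_tree degen_tree.
Proof.
have [_ [_ _] _ [qo qs] [col _]] := degen_tree_degen.
have wE u : white degen_tree (merge u) = white t u by rewrite /white col.
have [_ lab [rw root1 rb] bip leaf] := treeT.
have sC f f' : fconnect (csucc degen_tree) f f' = (vert degen_tree f == vert degen_tree f').
  rewrite -(fconnect_morph (q := val) (s' := d)) ?fconnect_degen ?(valP f) ?(valP f') //.
have mr u : (merge u == merge (troot t)) = (u == troot t).
  have nr g : ~~ wr t g -> (v g == troot t) = false.
    by rewrite /wr negb_or => /andP[_ /negPf].
  rewrite mergeE [troot t == _]eq_sym nr //.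
  by case: (eqVneq u (v k)) => [->|//]; rewrite !nr.
have rib' : is_ribbon degen_tree.
  split=> //.
  - by move=> f; apply: val_inj; rewrite !qo oK.
  - by move=> f; rewrite -val_eqE qo oflag_neq.
  - exact: fconnect_fibres_inj sC.
  - have adj f : adjacency degen_tree (merge (v f)) (merge (v (o f))).
      apply/existsP; case: (boolP ((f != h) && (f != k))) => [fF|].
        by exists (toF f); rewrite /= toFK // toFK ?oF // !eqxx.
      have vhm : v hm = v h by exact: vert_finv.
      have mk : merge (v k) = merge (v km).
        by apply/eqP; rewrite mergeE eqxx (negPf kmV).
      (* For the two flags of the lost edge, the edge of [hm] joins the same merged vertices. *)
      rewrite negb_and !negbK => /orP[/eqP->|/eqP->].
        by exists (toF hm); rewrite /= (toFK kmF) toFK ?oF // vhm mk !eqxx.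
      exists (toF km); rewrite /= (toFK (oF kmF)) toFK ?oK //.
      by rewrite vhm mk !eqxx.
    move=> u w; have [_ _ _ _ /(_ (val u) (val w)) /connectP[l]] := rib.
    have mval x : merge (val x) = x by apply: val_inj; rewrite val_merge (negPf (valP x)).
    move=> tl wl; suff : connect (adjacency degen_tree) (merge (val u)) (merge (val w)).
      by rewrite !mval.
    elim: l (val u) tl wl => [|z l IH] x /=.
      by move=> _ ->; exact: connect0.
    move=> /andP[/existsP[f /andP[/eqP <- /eqP <-]] zr] /(IH _ zr).
    by apply: connect_trans; exact: connect1.
split=> //.
- split=> //; apply/eqP; rewrite -eqSS; apply/eqP.
  have cV : #|{: degenV}|.+1 = #|V|.
    by rewrite card_sig -(cardC (pred1 (v k))) card1 add1n.
  have cF : #|{: degenF}|.+2 = #|F|.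
    rewrite card_sig -[RHS](cardC (pred2 h k)) card2 eq_sym oflag_neq //.
    by congr _.+2; apply: eq_card => f; rewrite !inE negb_or.
  rewrite cV (tree_card treeT); congr _.+1.
  apply/eqP; rewrite -(eqn_pmul2r (isT : 0 < 2)%N) -card_flags // -cF.
  by rewrite mulSn -card_flags.
- move=> i; have [u [ui uU]] := lab i; exists (merge u); split; first by rewrite col.
  move=> w wi; have -> : u = val w by apply: uU.
  by apply: val_inj; rewrite val_merge (negPf (valP w)).
- split; first by rewrite wE.
  + have [r rr] := root_flag_exists treeT.
    have rF : (r != h) && (r != k).
      have rwr : wr t r by rewrite /wr rr eqxx orbT.
      rewrite andbC (contraTneq _ rwr) => [|->//].
      by apply: contraTneq hw => <-; rewrite rr.
    apply/eqP/fintype.card1P; exists (toF r) => f; rewrite !inE /= mr.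
    apply/eqP/eqP => [fr|->]; last by rewrite toFK.
    by apply: val_inj; rewrite toFK //; exact: root_flag_uniq fr rr.
  + move=> f /eqP; rewrite mr => /eqP /rb; rewrite /= toFK ?oF ?(valP f) //.
    by rewrite wE.
- move=> f; rewrite !mr /= toFK ?oF ?(valP f) // !wE; exact: bip.
(* No black leaf arises: a surviving black flag still has a successor different from itself. *)
- move=> u ur; apply: contra_eqT => ub; rewrite /arity.
  have [f fu] := flag_at h (val u) rib.
  have fr : ~~ wr t f.
    rewrite /wr fu negb_or ub; apply: contraNneq ur => {}ur.
    by apply/eqP/val_inj; rewrite val_merge -ur (negPf (valP u)).
  have fF : (f != h) && (f != k).
    by apply/andP; split; [apply: contraNneq fr|apply: contraNneq (valP u)] => E;
      rewrite -?fu E.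
  have : (1 < valence degen_tree u)%N; last by case: valence => [|[]].
  rewrite valence_gt1 //; apply/existsP; exists (toF f); apply/andP; split.
    by rewrite /= toFK // fu -val_eqE val_merge (negPf (valP u)).
  have /andP[_ fk] := fF.
  rewrite -val_eqE qs toFK // degen_succ_black //.
  case: (eqVneq (s f) km) => _.
    by apply: contraNneq (valP u) => E; rewrite -fu -E vs.
  case: (eqVneq (s f) k) => [E|_]; last exact: black_succ_neq.
  by have := valP u; rewrite -fu -vs E eqxx.
Qed.

End DegenerationExists.

(** * The word determines the tree *)

Lemma iter_mod_order (T : finType) (f : T -> T) x i : injective f ->
  iter (i %% order f x) f x = iter i f x.
Proof.
move=> fI; rewrite [in RHS](divn_eq i (order f x)) addnC iterD; congr iter.
by elim: (i %/ _)%N => //= m IH; rewrite mulSn iterD -IH iter_order.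
Qed.

Lemma eq_iter_order (T : finType) (f : T -> T) x i j : injective f ->
  (iter i f x == iter j f x) = (i == j %[mod order f x])%N.
Proof.
move=> fI; rewrite -(iter_mod_order x i fI) -(iter_mod_order x j fI).
apply/eqP/eqP => [/(congr1 (findex f x))|->//].
by rewrite !findex_iter ?ltn_pmod ?order_gt0.
Qed.

Section DegenerationIso.
Context {n : nat} {V F : finType}.
Variables (t : tree_data n V F) (h : F).

Lemma is_degeneration_iso (V1 F1 V2 F2 : finType) (t1 : tree_data n V1 F1)
    (t2 : tree_data n V2 F2) p q p1 q1 :
  is_degeneration t h t1 p q -> tree_iso t1 t2 p1 q1 ->
  exists q2, is_degeneration t h t2 (p1 \o p) q2.
Proof.
move=> [[p_surj pE] [qI codomE] vq [oq sq] [col rt]] [[[p1' p1K p1'K] [q1' q1K q1'K] v1 o1 s1] c1 r1].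
exists (q \o q1'); split=> /=.
- split=> [u|u w]; first by have [w wu] := p_surj (p1' u); exists w; rewrite wu p1'K.
  by rewrite -pE; split=> [/(can_inj p1K)|->].
- split=> [f g /qI/(can_inj q1'K)//|f]; rewrite -codomE.
  apply/codomP/codomP => -[g ->]; first by exists (q1' g).
  by exists (q1 g); rewrite /= q1K.
- by move=> f; rewrite -vq -v1 q1'K.
- by split=> f; rewrite -?oq -?sq -{1}(q1'K f) ?o1 ?s1 q1K.
- by split=> [u|]; rewrite ?c1 ?r1 ?rt.
Qed.

Lemma degeneration_exists : is_tree t -> white t (vert t h) ->
  (1 <= arity t (vert t h))%N ->
  exists (t' : ord_tree n) p q, is_degeneration t h t' p q.
Proof.
move=> tT hw h1; have [t' [p [q iso]]] := ord_tree_exists (degen_tree_is_tree tT hw h1).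
have [q' ?] := is_degeneration_iso (degen_tree_degen tT hw h1) iso.
by exists t', (p \o merge tT h1), q'.
Qed.

End DegenerationIso.

Section WordDeterminesTree.
Context {R : realType} {n : nat}.

Section OneTree.
Context {V F : finType}.
Variables (t : tree_data n V F) (x : wflag t -> R) (r : F).
Hypotheses (treeT : is_tree t) (rr : vert t r = troot t).

Lemma wr_root : wr t r. Proof. by rewrite /wr rr eqxx orbT. Qed.

Lemma wr_iter_walk i f : wr t (iter i (walk t) f) = wr t f.
Proof. by elim: i => //= i IH; rewrite wr_walk. Qed.

Lemma wr_iterP f : wr t f -> exists i, iter i (walk t) r = f.
Proof.
move=> fw; apply/fconnect_iterP/fconnect_walk => //.
by rewrite fw wr_root.
Qed.

Lemma wr_label f g : wr t f -> wr t g ->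
  vert t f = vert t g <-> tcol t (vert t f) = tcol t (vert t g).
Proof.
move=> fw gw; split=> [->//|E].
have rN : tcol t (troot t) = None.
  by have := root_black treeT; rewrite /white negbK => /eqP.
case/orP: fw => [fw|/eqP fr]; first exact: white_label E.
case/orP: gw => [gw|/eqP gr]; first by apply/esym/(white_label treeT gw).
by rewrite fr gr.
Qed.

(** With no zero length the word skips the root flag only, so it records the whole walk. *)
Lemma word_orbit : (forall e, x e != 0) ->
  [seq (tcol t (vert t f), ext x f) | f <- orbit (walk t) r] = (None, 0) :: word x r.
Proof.
move=> x0; have rb := root_black treeT.
have rN : tcol t (troot t) = None by move: rb; rewrite /white negbK => /eqP.
have [L oL] : exists L, orbit (walk t) r = r :: L by rewrite /orbit -orderSpred; eexists.
rewrite /word oL /= {1 2}ext_black ?rr // eqxx rN; congr (_ :: map _ _).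
rewrite (eq_in_filter (a2 := predT)) ?filter_predT // => f fL.
have fr : f != r.
  by apply: contraTneq fL => ->; have := orbit_uniq (walk t) r; rewrite oL => /andP[].
have fw : wr t f.
  have : f \in orbit (walk t) r by rewrite oL inE fL orbT.
  by rewrite -fconnect_orbit => /fconnect_iterP[i <-]; rewrite wr_iter_walk wr_root.
by have [e _ ->] := ext_white x (wr_white treeT rr fw fr); rewrite x0.
Qed.

End OneTree.

Context {V F V' F' : finType}.
Variables (t : tree_data n V F) (t' : tree_data n V' F').
Variables (x : wflag t -> R) (x' : wflag t' -> R) (r : F) (r' : F').
Hypotheses (treeT : is_tree t) (treeT' : is_tree t').
Hypotheses (rr : vert t r = troot t) (rr' : vert t' r' = troot t').
Hypotheses (x0 : forall e, x e != 0) (x'0 : forall e, x' e != 0).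
Hypothesis eq_word : word x r = word x' r'.
Local Notation M := (walk t).
Local Notation M' := (walk t').

Let MI : injective M. Proof. exact: walk_inj. Qed.
Let M'I : injective M'. Proof. exact: walk_inj. Qed.

Let eq_order : order M r = order M' r'.
Proof.
have := word_orbit treeT rr x0; rewrite eq_word -(word_orbit treeT' rr' x'0).
by move/(congr1 size); rewrite !size_map !size_orbit.
Qed.

Let eq_letter i : tcol t (vert t (iter i M r)) = tcol t' (vert t' (iter i M' r')) /\
  ext x (iter i M r) = ext x' (iter i M' r').
Proof.
rewrite -(iter_mod_order r i MI) -(iter_mod_order r' i M'I) -eq_order.
have io : (i %% order M r < order M r)%N by rewrite ltn_pmod ?order_gt0.
have := word_orbit treeT rr x0; rewrite eq_word -(word_orbit treeT' rr' x'0).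
move/(congr1 (nth (None, 0) ^~ (i %% order M r)%N)).
rewrite (nth_map r) ?size_orbit // (nth_map r') ?size_orbit -?eq_order //.
rewrite !nth_traject -?eq_order //; by case=> -> ->.
Qed.

(** Matches the two walks position by position, starting at the root flags. *)
Let theta f := iter (findex M r f) M' r'.

Let thetaE i : theta (iter i M r) = iter i M' r'.
Proof.
apply/eqP; rewrite /theta eq_iter_order // -eq_order -eq_iter_order //.
by rewrite iter_findex // fconnect_iter.
Qed.

Let theta_iter i f : wr t f -> theta (iter i M f) = iter i M' (theta f).
Proof.
by move=> /(wr_iterP treeT rr)[j <-]; rewrite -iterD !thetaE iterD.
Qed.

Let theta_wr f : wr t f -> wr t' (theta f).
Proof.
by move=> /(wr_iterP treeT rr)[j <-]; rewrite thetaE wr_iter_walk ?wr_root.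
Qed.

Let theta_inj f g : wr t f -> wr t g -> theta f = theta g -> f = g.
Proof.
move=> /(wr_iterP treeT rr)[i <-] /(wr_iterP treeT rr)[j <-]; rewrite !thetaE.
by move=> /eqP; rewrite eq_iter_order // -eq_order -eq_iter_order // => /eqP.
Qed.

Let theta_letter f : wr t f ->
  tcol t (vert t f) = tcol t' (vert t' (theta f)) /\ ext x f = ext x' (theta f).
Proof.
by move=> /(wr_iterP treeT rr)[j <-]; rewrite thetaE; exact: eq_letter.
Qed.

Let theta_vert f g : wr t f -> wr t g ->
  vert t f = vert t g <-> vert t' (theta f) = vert t' (theta g).
Proof.
move=> fw gw; rewrite (wr_label treeT fw gw).
rewrite (wr_label treeT' (theta_wr fw) (theta_wr gw)).
by rewrite (theta_letter fw).1 (theta_letter gw).1.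
Qed.

(** Visits to the vertex of [f] show in the labels, so the first return takes equally many steps in
    both trees. *)
Let theta_csucc f : wr t f -> theta (csucc t f) = csucc t' (theta f).
Proof.
move=> fw; have fw' := theta_wr fw.
have [j [jE jmin]] := walk_first_return treeT f.
have [j' [j'E j'min]] := walk_first_return treeT' (theta f).
have ret i : vert t (iter i M f) = vert t f <->
    vert t' (iter i M' (theta f)) = vert t' (theta f).
  by rewrite theta_vert ?wr_iter_walk // theta_iter.
have jj' : j = j'.
  apply/eqP; rewrite eqn_leq; apply/andP; split; rewrite leqNgt; apply/negP => lt.
    have /eqP[] := jmin j'.+1 lt; apply/ret.
    by rewrite j'E vert_csucc //; exact: tree_ribbon.
  have /eqP[] := j'min j.+1 lt; apply/ret.
  by rewrite jE vert_csucc //; exact: tree_ribbon.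
by rewrite -jE theta_iter // jj' j'E.
Qed.

(** [theta] is controlled on [wr] flags only; the other end of each edge follows through the
    involution. *)
Let q f := if wr t f then theta f else oflag t' (theta (oflag t f)).

Let q_wr f : wr t' (q f) = wr t f.
Proof.
rewrite /q; case: ifP => fw; first exact: theta_wr.
by rewrite wr_oflag // theta_wr // wr_oflag // fw.
Qed.

Let q_oflag f : oflag t' (q f) = q (oflag t f).
Proof.
have oK := oflagK (tree_ribbon treeT); have oK' := oflagK (tree_ribbon treeT').
by rewrite /q wr_oflag //; case: ifP => fw /=; rewrite ?oK ?oK'.
Qed.

Let q_csucc f : csucc t' (q f) = q (csucc t f).
Proof.
have oK := oflagK (tree_ribbon treeT); have oK' := oflagK (tree_ribbon treeT').
case: (boolP (wr t f)) => fw.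
  by rewrite /q wr_csucc // fw theta_csucc.
have ofw : wr t (oflag t f) by rewrite wr_oflag.
have osw : wr t (oflag t (csucc t f)) by rewrite wr_oflag // wr_csucc.
apply: (can_inj oK'); apply: (csucc_inj (tree_ribbon treeT')).
(* [walk t (oflag t f)] is the successor of [oflag t (csucc t f)]; that outer successor, at a [wr]
   flag, already commutes with [theta] and can be cancelled. *)
have := theta_iter 1 ofw; rewrite /= /walk /cnext oK theta_csucc // => E.
by rewrite q_oflag /q osw E (negPf fw).
Qed.

Let q_inj : injective q.
Proof.
have oK := oflagK (tree_ribbon treeT); have oK' := oflagK (tree_ribbon treeT').
move=> f g E; have fg : wr t f = wr t g by rewrite -!q_wr E.
move: E; rewrite /q -fg; case: ifP => fw.
  by apply: theta_inj => //; rewrite -fg.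
by move=> /(can_inj oK')/theta_inj E; apply: (can_inj oK); apply: E;
  rewrite wr_oflag -?fg // fw.
Qed.

Let q_bij : bijective q.
Proof.
have oK' := oflagK (tree_ribbon treeT').
have qW f' : wr t' f' -> exists f, q f = f'.
  move=> /(wr_iterP treeT' rr')[i <-]; exists (iter i M r).
  by rewrite /q wr_iter_walk // wr_root // thetaE.
have /choice[g gK] : forall f', exists f, q f = f'.
  move=> f'; case: (boolP (wr t' f')) => [/qW//|fb].
  have [|f fE] := qW (oflag t' f'); first by rewrite wr_oflag.
  by exists (oflag t f); rewrite -q_oflag fE oK'.
by exists g => // f; apply: q_inj; rewrite gK.
Qed.

Lemma word_tree_iso : exists p q,
  tree_iso t t' p q /\ forall e e', val e' = q (val e) -> x' e' = x e.
Proof.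
have rib := tree_ribbon treeT; have rib' := tree_ribbon treeT'.
have [p iso] := graph_iso_of_flags r rib rib' q_bij q_oflag q_csucc.
exists p, q; split; last first.
  move=> e e' ee'; rewrite -!ext_val ee' /q; have ew := white_wr (valP e).
  by rewrite ew (theta_letter ew).2.
have wN f : ~~ wr t f -> tcol t (vert t f) = None.
  by rewrite /wr negb_or /white negbK => /andP[/eqP].
have wN' f : ~~ wr t' f -> tcol t' (vert t' f) = None.
  by rewrite /wr negb_or /white negbK => /andP[/eqP].
split=> // [u|].
  have [f <-] := flag_at r u rib; rewrite -(vert_iso iso).
  case: (boolP (wr t f)) => fw; last by rewrite wN // wN' // q_wr.
  by rewrite /q fw (theta_letter fw).1.
rewrite -rr -rr' -(vert_iso iso) /q wr_root //.
by rewrite (thetaE 0).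
Qed.

End WordDeterminesTree.

(** The root flag is fixed, and it generates all flags under [oflag] and [csucc]. *)
Lemma tree_automorphism (n : nat) (V F : finType) (t : tree_data n V F) p q :
  is_tree t -> tree_iso t t p q -> q =1 id.
Proof.
move=> tT [iso _ tr] f; have rib := tree_ribbon tT.
have [r rr] := root_flag_exists tT; apply/eqP.
apply: (flag_ind rib (P := fun f => q f == f)) (f).
- by apply/eqP/(root_flag_uniq tT _ rr); rewrite (vert_iso iso) rr -tr.
- by move=> g /eqP qg; rewrite -(oflag_iso iso) qg.
- by move=> g /eqP qg; rewrite -(csucc_iso iso) qg.
Qed.

(** * The topological type of a cactus *)

Section NextAlternate.
Variables (T : finType) (s : T -> T) (a : pred T).

(** Meant for the outer flags at a vertex of a cactus, which occupy every second place: the next one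
    is two steps further. *)
Lemma next_filter_orbit x : injective s -> a x -> ~~ a (s x) -> a (s (s x)) ->
  next [seq y <- orbit s x | a y] x = s (s x).
Proof.
move=> sI ax asx assx; have sx : s x != x by apply: contraNneq asx => ->.
have [y [m oE]] : exists y m, orbit s x = [:: x, s x & traject s y m] /\ y = s (s x).
  have : (1 < order s x)%N.
    rewrite -size_orbit ltnNge; apply: contra sx => sz.
    have : s x \in orbit s x by rewrite -fconnect_orbit fconnect1.
    rewrite /orbit -orderSpred /= inE => /orP[//|].
    by move: sz; rewrite size_orbit -orderSpred ltnS leqn0 => /eqP->.
  rewrite /orbit; case: (order s x) => [//|[//|m]] _.
  by exists (s (s x)), m.
case: oE => oE yE; have := cycle_orbit sI x; rewrite oE /= ax (negPf asx) /=.
case: m oE => [|m] oE /=; first by rewrite !eqxx /= andbT => /eqP.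
by rewrite yE assx /= !eqxx.
Qed.

End NextAlternate.

Section Cactus.
Context {R : realType} {n : nat} {V F : finType}.
Variable c : cactus_data R n V F.
Hypothesis cC : is_cactus c.
Local Notation v := (vert c).
Local Notation o := (oflag c).
Local Notation s := (csucc c).
Local Notation N := (cnext c).
Local Notation T := (topological_type c).

Lemma cactus_ribbon : is_ribbon c. Proof. by case: cC => -[[]]. Qed.
Let rib := cactus_ribbon.
Let oK := oflagK rib.
Let sI := csucc_inj rib.
Let vs := vert_csucc rib.
Let NI := cnext_inj rib.

Lemma cnext_label f f' : fconnect N f f' = (clab c f == clab c f').
Proof. by case: cC => _ []. Qed.

Lemma outer_oflag f : outer c (o f) = ~~ outer c f.
Proof.
have [[_ outP _ _] _ _ _] := cC; have := outP f.
by do 2!case: outer.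
Qed.

Lemma outer_cnext f : outer c (N f) = outer c f.
Proof. by rewrite /outer -same_fconnect1_r. Qed.

Lemma outer_finv f : outer c (finv N f) = outer c f.
Proof. by rewrite -outer_cnext (f_finv NI). Qed.

(** [csucc] is [cnext] after [oflag]: the former stays on its cycle, and the latter changes sides as
    every edge has just one outer flag. So outer and inner flags alternate around each vertex. *)
Lemma outer_csucc f : outer c (s f) = ~~ outer c f.
Proof. by rewrite -[f in LHS]oK -/(cnext c (o f)) outer_cnext outer_oflag. Qed.

Lemma outer_label f : outer c f = (clab c f == ord0).
Proof.
by have [_ _ <- _] := cC; rewrite /outer cnext_label eq_sym.
Qed.

Lemma outer_unlift f : outer c f = (unlift ord0 (clab c f) == None).
Proof.
rewrite outer_label; case: unliftP => [i ->|->]; last by rewrite !eqxx.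
by rewrite (eq_sym _ ord0) (negPf (neq_lift _ _)).
Qed.

Lemma type_white f : white T (type_vert c (inl f)) = ~~ outer c f.
Proof. by rewrite outer_unlift /white /=; case: unlift. Qed.

Lemma type_vert_outer f : outer c f -> type_vert c (inl f) = inl (inl (v f)).
Proof. by rewrite outer_unlift /= => /eqP->. Qed.

Lemma type_succ_outer f : outer c f -> type_succ c (inl f) =
  if s (s f) == cbase c then inr true else inl (s (s f)).
Proof.
move=> fo; rewrite /type_succ fo next_filter_orbit //.
  by rewrite outer_csucc fo.
by rewrite !outer_csucc fo.
Qed.

Lemma type_succ_inner f : ~~ outer c f -> type_succ c (inl f) = inl (finv N f).
Proof. by rewrite /type_succ => /negPf->. Qed.

Lemma type_opp_outer f : outer c f -> type_opp c (inl f) = inl (N (o f)).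
Proof. by rewrite /type_opp => ->. Qed.

Lemma type_opp_inner f : ~~ outer c f -> type_opp c (inl f) = inl (o (finv N f)).
Proof. by rewrite /type_opp => /negPf->. Qed.

Lemma type_oppK : involutive (type_opp c).
Proof.
move=> [f|b]; last by rewrite /= negbK.
case: (boolP (outer c f)) => fo.
  rewrite type_opp_outer // type_opp_inner; last by rewrite outer_cnext outer_oflag fo.
  by rewrite (finv_f NI) oK.
rewrite type_opp_inner // type_opp_outer; last by rewrite outer_oflag outer_finv.
by rewrite oK (f_finv NI).
Qed.

Lemma type_vert_succ f : type_vert c (type_succ c f) = type_vert c f.
Proof.
have base : outer c (cbase c) by rewrite /outer connect0.
case: f => [f|[]] //; last by rewrite [LHS]type_vert_outer.
case: (boolP (outer c f)) => fo; last first.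
  rewrite type_succ_inner //= (_ : clab c (finv N f) = clab c f).
    by case: unliftP => // E; move: fo; rewrite outer_label E eqxx.
  by apply/eqP; rewrite -cnext_label -(same_fconnect_finv NI) fconnect_sym
    ?fconnect1 //; exact: finv_inj.
rewrite type_succ_outer // type_vert_outer //.
case: (eqVneq (s (s f)) (cbase c)) => [E|_]; first by rewrite /= -E !vs.
by rewrite type_vert_outer ?outer_csucc ?fo // !vs.
Qed.

Lemma fconnect_type_succ f f' :
  fconnect (type_succ c) f f' = (type_vert c f == type_vert c f').
Proof.
have base : outer c (cbase c) by rewrite /outer connect0.
apply/idP/eqP => [|].
  move=> /(fconnect_closed (P := fun z => type_vert c f == type_vert c z)) H.
  by apply/eqP/H => // z; rewrite type_vert_succ.
have ss f1 : outer c f1 -> fconnect (type_succ c) (inl f1) (inl (s (s f1))).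
  move=> f1o; have := fconnect1 (type_succ c) (inl f1).
  rewrite type_succ_outer //; case: (eqVneq (s (s f1)) (cbase c)) => // ->.
  by move=> /connect_trans; apply; exact: (fconnect1 (type_succ c) (inr true)).
(* By the alternation, two outer flags at a vertex are an even number of steps apart. *)
have out f1 f2 : outer c f1 -> outer c f2 -> v f1 = v f2 ->
    fconnect (type_succ c) (inl f1) (inl f2).
  move=> o1 o2 /eqP; rewrite -fconnect_csucc // => /fconnect_iterP[i iE].
  have oi j : outer c (iter j s f1) = ~~ odd j.
    by elim: j => //= j IH; rewrite outer_csucc IH.
  have ev : ~~ odd i by rewrite -oi iE.
  rewrite -iE -[i]odd_double_half (negPf ev) add0n; elim: i./2 => [|j IH].
    exact: connect0.
  by apply: connect_trans IH _; rewrite doubleS; apply: ss; rewrite oi odd_double.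
have tb f1 : outer c f1 -> v f1 = v (cbase c) ->
    fconnect (type_succ c) (inl f1) (inr true).
  (* [g] is the outer flag preceding [cbase c], hence the one followed by the root edge. *)
  move=> o1 v1; set g := finv s (finv s (cbase c)).
  have gE : s (s g) = cbase c by rewrite /g !f_finv.
  have go : outer c g by rewrite -[outer _ _]negbK -!outer_csucc gE.
  apply: connect_trans (out f1 g o1 go _) _; first by rewrite v1 -gE !vs.
  by have := fconnect1 (type_succ c) (inl g); rewrite type_succ_outer // gE eqxx.
have bt : fconnect (type_succ c) (inr true) (inl (cbase c)).
  exact: (fconnect1 (type_succ c) (inr true)).
case: f => [f|[]]; case: f' => [f'|[]] //; rewrite ?connect0 //=; last 4 first.
- case E: unlift => [//|] [fv]; apply: tb => //.
  by rewrite outer_unlift E.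
- by case: unlift.
- case E: unlift => [//|] [fv]; apply: connect_trans bt (out _ _ base _ fv).
  by rewrite outer_unlift E.
- by case: unlift.
case E: unlift => [i|]; case E': unlift => [j|] //.
  move=> [ij]; have fi : ~~ outer c f by rewrite outer_unlift E.
  have : fconnect (finv N) f f'.
    rewrite (same_fconnect_finv NI) cnext_label.
    by move: E E'; do 2!case: unliftP => // ? ->; move=> [->] [->]; rewrite ij.
  move=> /fconnect_iterP[k <-]; elim: k => [|k IH]; first exact: connect0.
  apply: connect_trans IH _ => /=.
  have := fconnect1 (type_succ c) (inl (iter k (finv N) f)).
  rewrite type_succ_inner //; elim: k => //= k IH.
  by rewrite outer_finv.
by move=> [ff']; apply: out => //; rewrite outer_unlift ?E ?E'.
Qed.

Lemma type_ribbon : is_ribbon T.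
Proof.
split.
- exact: type_oppK.
- move=> [f|[]] //=; apply/eqP => -[] E.
  have : outer c f = ~~ outer c f; last by case: outer.
  rewrite -[in LHS]E; case: ifP => fo; first by rewrite outer_cnext outer_oflag fo.
  by rewrite outer_oflag outer_finv fo.
- exact: fconnect_fibres_inj fconnect_type_succ.
- exact: fconnect_type_succ.
have cS := sym_connect_sym (adjacency_sym (G := T) type_oppK).
have adj f : connect (adjacency T) (type_vert c f) (type_vert c (type_opp c f)).
  by apply/connect1/existsP; exists f; rewrite /= !eqxx.
pose P f := connect (adjacency T) (type_vert c (inr true)) (type_vert c (inl f)).
have labN f : ~~ outer c f -> type_vert c (inl (N f)) = type_vert c (inl f).
  move=> fi; rewrite -[in RHS](finv_f NI f) -type_succ_inner ?outer_cnext //.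
  by rewrite type_vert_succ.
(* In the type, the opposite of an outer [f] is [N (o f)], which is on the same lobe as [o f]. *)
have Po1 f : outer c f -> connect (adjacency T) (type_vert c (inl f)) (type_vert c (inl (o f))).
  move=> fo; have := adj (inl f); rewrite type_opp_outer // labN //.
  by rewrite outer_oflag fo.
have Po f : P f -> P (o f).
  rewrite /P => Pf; apply: connect_trans Pf _; case: (boolP (outer c f)) => fo.
    exact: Po1.
  by rewrite cS -{2}(oK f); apply: Po1; rewrite outer_oflag.
have sN f : s f = N (o f) by rewrite /cnext oK.
have Ps1 f : outer c f -> type_vert c (inl (s f)) = type_vert c (inl (o f)).
  by move=> fo; rewrite sN labN // outer_oflag fo.
have Ps f : P f -> P (s f).
  case: (boolP (outer c f)) => fo; first by rewrite /P Ps1 // => /Po.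
  have go : outer c (finv s f) by rewrite -[outer _ _]negbK -outer_csucc f_finv.
  have -> : P f = P (o (finv s f)) by rewrite /P -Ps1 // f_finv.
  move=> /Po; rewrite oK /P !type_vert_outer ?outer_csucc //.
  by rewrite vs vert_finv.
have Pall f : P f.
  apply: (flag_ind rib (P := P) (f0 := cbase c)) => //.
  by rewrite /P type_vert_outer ?connect0 // /outer connect0.
have all u : connect (adjacency T) (type_vert c (inr true)) u.
  case: u => [[u|i]|[]].
  - have [f fu] := flag_at (cbase c) u rib.
    case: (boolP (outer c f)) => fo; first by have := Pall f; rewrite /P type_vert_outer // fu.
    have := Pall (s f); rewrite /P type_vert_outer ?vs ?fu //.
    by rewrite outer_csucc.
  - have [_ [_ /(_ (lift ord0 i))[f fi]] _ _] := cC.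
    by have := Pall f; rewrite /P /= fi liftK.
  - exact: (adj (inr true)).
by move=> u w; apply: connect_trans (all w); rewrite cS.
Qed.

Lemma type_is_tree : is_tree T.
Proof.
have [[[_ gen] outP val0 valP] [labP labS] labb _] := cC.
have trib := type_ribbon.
have base : outer c (cbase c) by rewrite /outer connect0.
split.
- split=> //; have -> : nedges T = (nedges c).+1.
    apply/eqP; rewrite -(eqn_pmul2r (isT : 0 < 2)%N) -card_flags // card_sum card_bool.
    by rewrite (card_flags rib) mulSn addnC.
  (* The genus formula with [n.+1] cycles reads [#|V| + n.+1 = nedges c + 2]. The type has [n.+1]
     more vertices, the lobes and the root, and one more edge. *)
  move: gen; rewrite /genus0 (ncycles_labelled rib labP labS) => gen.
  by rewrite !card_sum card_ord card_unit addn1 -addnS gen addn2.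
- move=> i; exists (inl (inr i)); split=> // -[[u|j]|[]] //= [->] //.
- split=> //.
    apply/eqP/fintype.card1P; exists (inr false) => -[f|[]]; rewrite !inE //=.
    by case: unlift.
  by move=> [f|[]] //=; case: unlift.
- move=> [f|[]]; rewrite ?eqxx //= => _ _.
  rewrite !type_white; case: (boolP (outer c f)) => fo /=.
    by rewrite outer_cnext outer_oflag fo.
  by rewrite outer_oflag outer_finv (negPf fo).
(* The base vertex carries the root edge besides [cbase c]. Elsewhere a single outer flag would
   mean, by the alternation, a valence of at most 2. *)
- move=> [[u|i]|[]] // _ ar; exfalso; move: ar; rewrite /arity.
  suff : (1 < valence T (inl (inl u)))%N by case: valence => [|[]].
  rewrite valence_gt1 //; apply/existsP.
  case: (eqVneq u (v (cbase c))) => [->|uv]; first by exists (inr true); rewrite /= !eqxx.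
  have [f [fo fu]] : exists f, outer c f /\ v f = u.
    have [f fu] := flag_at (cbase c) u rib.
    case: (boolP (outer c f)) => fo; first by exists f.
    by exists (s f); rewrite vs outer_csucc fo.
  exists (inl f); rewrite [vert T _]type_vert_outer // fu eqxx /=.
  rewrite -/(type_succ c (inl f)) type_succ_outer //.
  case: (eqVneq (s (s f)) (cbase c)) => [//|_].
  apply/eqP => -[ssf]; have := valP u uv.
  have -> : valence c u = order s f.
    by rewrite /order /valence; apply: eq_card => g; rewrite !inE fconnect_csucc // fu eq_sym.
  rewrite ltnNge (@order_le_cycle _ s [:: f; s f]) //= ?mem_head //.
  by rewrite ssf !eqxx.
Qed.

(** Every edge has exactly one inner flag, which can represent it in place of the orbit root. *)
Lemma total_length_inner : total_length c = \sum_(f | ~~ outer c f) clen c f.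
Proof.
have sC := fconnect_sym (can_inj oK).
have [_ _ _ [leno _]] := cC.
rewrite (partition_big (froot o) [in froots o]) /=; last first.
  by move=> f _; exact: roots_root.
apply: eq_bigr => r rr; rewrite (big_pred1 (if outer c r then o r else r)).
  by case: ifP; rewrite ?leno.
move=> f /=; have [rE] : froot o r = r by apply/eqP.
apply/andP/eqP => [[fi /eqP fr]|->].
  have := connect_root (frel o) f; rewrite fr sC.
  move=> /(fconnect_closed (P := pred2 r (o r))) H.
  have /orP[/eqP E|/eqP E] : pred2 r (o r) f.
    apply: H; last by rewrite /= eqxx.
    by move=> z /orP[] /eqP->; rewrite /= ?oK eqxx ?orbT.
  - by rewrite -E (negPf fi).
  - by move: fi; rewrite E outer_oflag negbK => ->.
case: ifP => ro; rewrite ?outer_oflag ro; split=> //.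
  by rewrite -[X in _ == X]rE root_connect // sC fconnect1.
Qed.

Lemma total_length_lobes :
  total_length c = \sum_(i | i != ord0) cycle_length c i.
Proof.
rewrite total_length_inner (partition_big (clab c) (fun i => i != ord0)) /=; last first.
  by move=> f; rewrite outer_label.
apply: eq_bigr => i i0; apply: eq_bigl => f.
by rewrite outer_label; case: (eqVneq (clab c f) i) => [->|_]; rewrite ?i0 ?andbF.
Qed.

End Cactus.

(** * Functoriality of the topological type, and recovery of the cactus *)

Section TypeFunctor.
Context {R : realType} {n : nat} {V F V' F' : finType}.
Variables (c : cactus_data R n V F) (c' : cactus_data R n V' F').
Hypotheses (cC : is_cactus c) (c'C : is_cactus c').
Local Notation T := (topological_type c).
Local Notation T' := (topological_type c').

Section Functor.
Variables (p : V -> V') (q : F -> F').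
Hypotheses (iso : graph_iso c c' p q) (cb : cbase c' = q (cbase c)).
Hypothesis cl : forall f, clab c' (q f) = clab c f.

Lemma type_iso : exists p1 q1, tree_iso T T' p1 q1 /\ forall f, q1 (inl f) = inl (q f).
Proof.
have qo f : outer c' (q f) = outer c f; first exact: (outer_iso f iso cb).
have qn f : finv (cnext c') (q f) = q (finv (cnext c) f).
  apply: (cnext_inj (cactus_ribbon c'C)).
  rewrite f_finv; last exact: (cnext_inj (cactus_ribbon c'C)).
  by rewrite (cnext_iso iso) f_finv //; exact: (cnext_inj (cactus_ribbon cC)).
have [[p' pK p'K] [q' qK q'K] vq oq sq] := iso.
pose p1 (u : V + 'I_n + unit) : V' + 'I_n + unit :=
  match u with inl (inl w) => inl (inl (p w)) | inl (inr i) => inl (inr i) | inr x => inr x end.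
pose q1 (f : F + bool) : F' + bool := match f with inl f => inl (q f) | inr b => inr b end.
exists p1, q1; split=> //; split=> //; last by move=> [[]|].
split.
- exists (fun u : V' + 'I_n + unit => match u with inl (inl w) => inl (inl (p' w))
    | inl (inr i) => inl (inr i) | inr x => inr x end).
    by move=> [[u|i]|u] //=; rewrite pK.
  by move=> [[u|i]|u] //=; rewrite p'K.
- exists (fun f : F' + bool => match f with inl f => inl (q' f) | inr b => inr b end).
    by move=> [f|b] //=; rewrite qK.
  by move=> [f|b] //=; rewrite q'K.
- by move=> [f|[]] //=; rewrite ?cl ?vq ?cb ?vq //; case: unlift.
- move=> [f|b] //=; rewrite qo; case: ifP => _; first by rewrite oq (cnext_iso iso).
  by rewrite qn oq.
- move=> [f|[]] //=; last by rewrite cb.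
  rewrite -/(type_succ c' (inl (q f))) -/(type_succ c (inl f)).
  case: (boolP (outer c f)) => fo.
    rewrite !type_succ_outer ?qo // !sq cb (inj_eq (can_inj qK)).
    by case: ifP.
  by rewrite !type_succ_inner ?qo //= qn.
Qed.

End Functor.

(** The formulas of the type are solved in this order: [type_succ] after [type_opp] is [oflag] on
    outer flags, hence [oflag] everywhere; [type_succ] on inner flags inverts [cnext]; this gives
    [csucc] on outer flags, and then on inner ones, because two steps from an outer flag are one
    [type_succ] up to the root edge. *)
Lemma type_iso_inv p1 q1 : tree_iso T T' p1 q1 ->
  exists p q, [/\ forall f, q1 (inl f) = inl (q f), graph_iso c c' p q,
    cbase c' = q (cbase c) & forall f, clab c' (q f) = clab c f].
Proof.
move=> isoT; have [isoG tc tr] := isoT.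
have q1r : q1 (inr false) = inr false.
  apply: (root_flag_uniq (type_is_tree c'C)) => //.
  by rewrite (vert_iso isoG) /= -tr.
have q1t : q1 (inr true) = inr true.
  by have := oflag_iso isoG (inr false); rewrite q1r /= => <-.
have bq1 : bijective q1 by case: isoG.
have q1I := bij_inj bq1.
have [q1' q1K q1'K] := bq1.
have /choice[q qE] : forall f, exists f', q1 (inl f) = inl f'.
  move=> f; case E: (q1 (inl f)) => [f'|[]]; first by exists f'.
    by have /q1I : q1 (inl f) = q1 (inr true) by rewrite E q1t.
  by have /q1I : q1 (inl f) = q1 (inr false) by rewrite E q1r.
have rib := cactus_ribbon cC; have rib' := cactus_ribbon c'C.
have oK := oflagK rib; have oK' := oflagK rib'.
have NI := cnext_inj rib; have NI' := cnext_inj rib'.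
have sI := csucc_inj rib; have sI' := csucc_inj rib'.
have qI : injective q.
  by move=> f g E; have /q1I[] : q1 (inl f) = q1 (inl g) by rewrite !qE E.
have bq : bijective q.
  have /choice[q' q'E] : forall f', exists f, q f = f'.
    move=> f'; case E: (q1' (inl f')) => [f|b].
      by exists f; have := q1'K (inl f'); rewrite E qE => -[].
    by have := q1'K (inl f'); rewrite E; case: b {E}; rewrite ?q1t ?q1r.
  by exists q' => // f; apply: qI; rewrite q'E.
have qo f : outer c' (q f) = outer c f.
  apply: negb_inj; rewrite -!type_white // -(white_iso _ isoT) -(vert_iso isoG).
  by rewrite qE.
have opp f : type_opp c' (inl (q f)) = q1 (type_opp c (inl f)).
  by rewrite -qE; exact: (oflag_iso isoG).
have suc f : type_succ c' (inl (q f)) = q1 (type_succ c (inl f)).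
  by rewrite -qE; exact: (csucc_iso isoG).
have cb : cbase c' = q (cbase c).
  have := csucc_iso isoG (inr true); rewrite q1t /= => E.
  by have := qE (cbase c); rewrite -E => -[].
have qoflag_o f : outer c f -> oflag c' (q f) = q (oflag c f).
  move=> fo; have No : ~~ outer c (cnext c (oflag c f)).
    by rewrite outer_cnext // outer_oflag // fo.
  have No' : ~~ outer c' (cnext c' (oflag c' (q f))).
    by rewrite outer_cnext // outer_oflag // qo fo.
  have := opp f; rewrite !type_opp_outer ?qo // qE => -[E].
  have := suc (cnext c (oflag c f)); rewrite -E !type_succ_inner // qE.
  by rewrite !finv_f // => -[].
have qoflag f : oflag c' (q f) = q (oflag c f).
  case: (boolP (outer c f)) => fo; first exact: qoflag_o.
  by apply: (can_inj oK'); rewrite oK' qoflag_o ?outer_oflag // oK.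
have qN f : ~~ outer c f -> cnext c' (q f) = q (cnext c f).
  move=> fi; have := suc (cnext c f); rewrite !type_succ_inner ?qo ?outer_cnext // qE finv_f //.
  by move=> -[<-]; rewrite f_finv.
have qs_o f : outer c f -> csucc c' (q f) = q (csucc c f).
  move=> fo; have : ~~ outer c (oflag c f) by rewrite outer_oflag // fo.
  by move/qN; rewrite -qoflag /cnext oK oK'.
have qs f : csucc c' (q f) = q (csucc c f).
  case: (boolP (outer c f)) => fo; first exact: qs_o.
  have fE : csucc c (finv (csucc c) f) = f by rewrite f_finv.
  set g := finv (csucc c) f in fE; have go : outer c g.
    by rewrite -[outer _ _]negbK -outer_csucc // fE.
  rewrite -fE -qs_o //; have := suc g; rewrite !type_succ_outer ?qo // cb.
  case: (eqVneq (csucc c (csucc c g)) (cbase c)) => [->|_].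
    by rewrite q1t; case: eqP => // ->.
  by rewrite qE; case: eqP => [//|_] [].
have [p isoc] := graph_iso_of_flags (cbase c) rib rib' bq qoflag qs.
exists p, q; split=> // f.
have := tc (type_vert c (inl f)); rewrite -[p1 _](vert_iso isoG) qE /=.
case: unliftP => [i ->|->]; case: unliftP => [j ->|->] //=.
by move=> [->].
Qed.

End TypeFunctor.

(** * The cactus of a tree with positive lengths *)

Lemma card_white (n : nat) (V F : finType) (t : tree_data n V F) :
  is_tree t -> #|white t| = n.
Proof.
move=> treeT; have [_ lab_t _ _ _] := treeT.
have /choice[w wP] : forall i, exists u, tcol t u = Some i.
  by move=> i; have [u [ui _]] := lab_t i; exists u.
have wI : injective w by move=> i j E; apply: Some_inj; rewrite -!wP E.
rewrite -[RHS]card_ord -(fintype.card_image wI); apply: eq_card => u.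
  rewrite [LHS]unfold_in; apply/idP/fintype.imageP => [uw|[i _ ->]]; last by rewrite /white wP.
  move: uw; rewrite /white; case E: tcol => [i|//] _; exists i => //.
  by apply: (white_label treeT); rewrite /white ?E ?wP.
Qed.

Section CactusOfTree.
Context {R : realType} {n : nat} {V F : finType}.
Variables (t : tree_data n V F) (x : wflag t -> R) (r : F).
Hypotheses (treeT : is_tree t) (x_gt0 : forall e, 0 < x e).
Hypothesis rr : vert t r = troot t.
Local Notation v := (vert t).
Local Notation o := (oflag t).
Local Notation s := (csucc t).

Let rib := tree_ribbon treeT.
Let oK := oflagK rib.
Let sI := csucc_inj rib.
Let vs := vert_csucc rib.
Let rwr : wr t r. Proof. exact: wr_root. Qed.
Let orb : ~~ wr t (o r). Proof. by rewrite wr_oflag // negbK. Qed.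
Let sr : s r = r. Proof. by apply: (root_flag_uniq treeT); rewrite ?vs. Qed.
Let sor : s (o r) != o r. Proof. exact: black_succ_neq. Qed.

Let blackE f : ~~ wr t f -> ~~ white t (v f) && (v f != troot t).
Proof. by rewrite /wr negb_or. Qed.

Let off f := (f != r) && (f != o r).

Let wr_off f : wr t f -> f != r -> off f.
Proof. by rewrite /off => fw -> /=; apply: contraTneq fw => ->. Qed.

Let bk_off f : ~~ wr t f -> f != o r -> off f.
Proof. by rewrite /off => fw ->; rewrite andbT; apply: contraNneq fw => ->. Qed.

Let off_wr f : off f -> wr t f -> white t (v f).
Proof. by move=> /andP[fr _] fw; exact: wr_white fr. Qed.

Definition offF := {f : F | (f != r) && (f != o r)}.
Definition blackV := {u : V | ~~ white t u && (u != troot t)}.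
HB.instance Definition _ := Finite.on offF.
HB.instance Definition _ := Finite.on blackV.

(* Read off the definition of the topological type: the outer flags are those
   at black vertices, and the inner cycles run backwards around white vertices. *)
Let opp f := if wr t f then o (finv s f) else s (o f).
(** In a type, an outer flag and its cactus successor are opposite, and two cactus successors of an
    outer flag make one tree successor, with the root edge skipped. *)
Let suc f := if wr t f then skip s (o r) (o f) else o f.
Let bv f := v (if wr t f then o f else f).
Let lab f : 'I_n.+1 := if tcol t (v f) is Some i then lift ord0 i else ord0.
Let len f := ext x (if wr t f then f else s (o f)).

Let base_off : off (s (o r)).
Proof. by apply: bk_off => //; rewrite wr_csucc. Qed.
Let offP (f : offF) : off (val f). Proof. exact: (valP f). Qed.

Let toF f : offF := insubd (exist _ (s (o r)) base_off) f.
Let toV u : blackV := insubd (exist _ (v (o r)) (blackE orb)) u.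

Definition cactus_of : cactus_data R n blackV offF := CactusData
  (Graph (fun f => toV (bv (val f))) (fun f => toF (opp (val f)))
    (fun f => toF (suc (val f))))
  (toF (s (o r))) (fun f => lab (val f)) (fun f => len (val f)).
Local Notation C := cactus_of.

Let toFK f : off f -> val (toF f) = f.
Proof. by move=> fF; rewrite val_insubd -/(off f) fF. Qed.

Let wr_opp f : wr t (opp f) = ~~ wr t f.
Proof.
rewrite /opp; case: ifP => fw; last by rewrite wr_csucc // wr_oflag // fw.
by rewrite wr_oflag // -wr_csucc // f_finv // fw.
Qed.

Let wr_suc f : wr t (suc f) = ~~ wr t f.
Proof.
rewrite /suc; case: ifP => fw; last by rewrite wr_oflag // fw.
by rewrite /skip; case: eqP; rewrite !wr_csucc ?wr_oflag // ?negbK ?rwr ?fw.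
Qed.

Let off_opp f : off f -> off (opp f).
Proof.
move=> /andP[fr fo]; case: (boolP (wr t f)) => fw.
  apply: bk_off; first by rewrite wr_opp fw.
  rewrite /opp fw (inj_eq (can_inj oK)); apply: contra fr => /eqP E.
  by rewrite -sr -E f_finv.
apply: wr_off; first by rewrite wr_opp.
rewrite /opp (negPf fw); apply: contra fo => /eqP E.
by apply/eqP; rewrite -[f]oK; congr o; apply: sI; rewrite E sr.
Qed.

Let off_suc f : off f -> off (suc f).
Proof.
move=> /andP[fr fo]; case: (boolP (wr t f)) => fw.
  apply: bk_off; first by rewrite wr_suc fw.
  by rewrite /suc fw skip_neq // (inj_eq (can_inj oK)).
apply: wr_off; first by rewrite wr_suc.
by rewrite /suc (negPf fw); apply: contra fo => /eqP <-; rewrite oK.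
Qed.

Let oppE f : val (oflag C f) = opp (val f).
Proof. by rewrite toFK // off_opp //; exact: offP. Qed.

Let sucE f : val (csucc C f) = suc (val f).
Proof. by rewrite toFK // off_suc //; exact: offP. Qed.

Let oppK f : opp (opp f) = f.
Proof.
rewrite {1}/opp wr_opp /opp; case: (boolP (wr t f)) => fw /=.
  by rewrite oK f_finv.
by rewrite finv_f // oK.
Qed.

(** On black flags this is the boundary walk without the root edge. As [s r = r], the walk leads
    from [o r] to [s (o r)], so omitting [o r] from the walk agrees with omitting it from [s]. *)
Let nxt f := if wr t f then finv s f else skip (walk t) (o r) f.

Let cnextE f : val (cnext C f) = nxt (val f).
Proof.
rewrite sucE oppE /suc wr_opp /opp /nxt; case: (boolP (wr t (val f))) => fw /=.
  by rewrite oK.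
by rewrite /skip /walk /cnext oK sr.
Qed.

Let black_bv f : ~~ white t (bv f) && (bv f != troot t).
Proof. by apply: blackE; rewrite /bv; case: ifP => [fw|->//]; rewrite wr_oflag // fw. Qed.

Let val_toV_bv f : val (toV (bv f)) = bv f.
Proof. by rewrite val_insubd black_bv. Qed.

Let bv_suc f : off f -> bv (suc f) = bv f.
Proof.
move=> fF; rewrite /bv wr_suc /suc; case: (boolP (wr t f)) => fw /=; last by rewrite oK.
by rewrite /skip; case: eqP => [<-|]; rewrite ?vs // -vs.
Qed.

(** Two steps of [suc] from a black flag are one step of [s] with [o r] skipped, and a [wr] flag is
    one step away from a black one. *)
Let fconnect_suc f f' : off f -> off f' -> fconnect suc f f' = (bv f == bv f').
Proof.
move=> fF f'F; apply/idP/idP.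
  move=> /(fconnect_closed (P := fun z => off z && (bv f == bv z))) H.
  have /andP[//] : off f' && (bv f == bv f').
  apply: H => [z /andP[zF /eqP ->]|]; last by rewrite fF eqxx.
  by rewrite off_suc // bv_suc // eqxx.
have bb g g' : ~~ wr t g -> ~~ wr t g' -> off g -> off g' -> v g = v g' ->
    fconnect suc g g'.
  move=> gb g'b /andP[_ go] /andP[_ g'o] /eqP; rewrite -fconnect_csucc //.
  rewrite -(fconnect_skip sI go g'o).
  move=> /(fconnect_closed (P := fun z => ~~ wr t z && fconnect suc g z)) H.
  suff /andP[//] : ~~ wr t g' && fconnect suc g g'.
  apply: H => [z /andP[zb gz]|]; last by rewrite gb connect0.
  have zE : suc (suc z) = skip s (o r) z.
    by rewrite {1}/suc wr_suc zb /suc (negPf zb) oK.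
  rewrite -zE !wr_suc negbK zb /=.
  by apply: connect_trans gz _; apply: (fconnect_iter suc 2).
have bw g : ~~ wr t g -> off f -> off g -> bv f = v g -> fconnect suc f g.
  move=> gb _ gF fg; case: (boolP (wr t f)) => fw.
    apply: connect_trans (fconnect1 suc f) (bb _ _ _ gb _ gF _).
    - by rewrite wr_suc fw.
    - exact: off_suc.
    - by rewrite -fg -bv_suc // /bv wr_suc fw.
  by apply: bb => //; rewrite -fg /bv (negPf fw).
move=> /eqP E; case: (boolP (wr t f')) => f'w; last first.
  by apply: bw => //; rewrite E /bv (negPf f'w).
have of'b : ~~ wr t (o f') by rewrite wr_oflag // negbK.
have -> : f' = suc (o f') by rewrite /suc (negPf of'b) oK.
apply: connect_trans (fconnect1 suc (o f')); apply: bw => //.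
  apply: bk_off => //; move: f'F => /andP[]; by rewrite (inj_eq (can_inj oK)).
by rewrite E /bv f'w.
Qed.

Let lab0 f : off f -> (lab f == ord0) = ~~ wr t f.
Proof.
move=> fF; case: (boolP (wr t f)) => fw.
  by have := off_wr fF fw; rewrite /white /lab; case: tcol.
by move: (blackE fw) => /andP[]; rewrite /white negbK /lab => /eqP->.
Qed.

Let fconnect_nxt f f' : off f -> off f' -> fconnect nxt f f' = (lab f == lab f').
Proof.
move=> fF f'F; case: (boolP (wr t f)) => fw; last first.
  rewrite (eq_in_fconnect (P := fun z => ~~ wr t z) (s := skip (walk t) (o r))) //.
  - move: (fF) (f'F) => /andP[_ fo] /andP[_ f'o].
    rewrite fconnect_skip //; last exact: walk_inj.
    have -> : lab f = ord0 by apply/eqP; rewrite lab0.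
    rewrite eq_sym lab0 //; apply/idP/idP => [ff'|f'w].
      apply: (fconnect_closed (P := fun z => ~~ wr t z)) ff' => // z.
      by rewrite wr_walk.
    by apply: fconnect_walk => //; rewrite (negPf fw) (negPf f'w).
  - by move=> z zb; rewrite /skip; case: eqP; rewrite !wr_walk.
  - by move=> z zb; rewrite /nxt (negPf zb).
rewrite (eq_in_fconnect (P := wr t) (s := finv s)) //.
- rewrite same_fconnect_finv // fconnect_csucc //.
  have fW := off_wr fF fw.
  apply/eqP/eqP => [E|]; first by rewrite /lab E.
  case: (boolP (wr t f')) => f'w; last first.
    by move=> E; have := lab0 f'F; rewrite -E lab0 // fw f'w.
  have := off_wr f'F f'w; move: fW; rewrite /lab /white.
  case E: (tcol t (v f)) => [i|//]; case E': (tcol t (v f')) => [j|//] _ _ /lift_inj ij.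
  by apply: (white_label treeT); rewrite /white ?E // E' ij.
- by move=> z zb; rewrite -wr_csucc // f_finv.
- by move=> z zb; rewrite /nxt zb.
Qed.

Let fconnect_cnextC f f' : fconnect (cnext C) f f' = (clab C f == clab C f').
Proof.
rewrite -fconnect_nxt ?offP //.
by apply/esym/fconnect_morph => [|z]; [exact: val_inj|rewrite cnextE].
Qed.

Let outerC f : outer C f = ~~ wr t (val f).
Proof.
rewrite /outer fconnect_cnextC eq_sym /=.
have -> : lab (val (toF (s (o r)))) = ord0.
  by apply/eqP; rewrite toFK // lab0 // wr_csucc.
by rewrite lab0 //; exact: offP.
Qed.

(** Connectedness comes from [t] by induction on flags: [o], and [s] at a black vertex, leave [bv]
    unchanged, while [s] at a white vertex crosses one edge of [C]. *)
Let ribC : is_ribbon C.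
Proof.
have sC f f' : fconnect (csucc C) f f' = (vert C f == vert C f').
  rewrite -(fconnect_morph (q := val) (s' := suc)); [|exact: val_inj|by move=> z; rewrite sucE].
  rewrite fconnect_suc ?offP //.
  by rewrite -[RHS]val_eqE /= !val_toV_bv.
have oC : involutive (oflag C) by move=> f; apply: val_inj; rewrite !oppE oppK.
split=> //.
- move=> f; apply/eqP => /(congr1 (wr t \o val)) /=; rewrite -[toF _]/(oflag C f) oppE wr_opp.
  by case: wr.
- exact: fconnect_fibres_inj sC.
have cS := sym_connect_sym (adjacency_sym oC).
pose P f := connect (adjacency C) (toV (bv r)) (toV (bv f)).
have bvo f : bv (o f) = bv f by rewrite /bv wr_oflag //; case: wr; rewrite /= ?oK.
have adj f : off f -> adjacency C (toV (bv f)) (toV (bv (opp f))).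
  move=> fF; apply/existsP; exists (toF f).
  by rewrite /= toFK // toFK ?off_opp // !eqxx.
have Pall f : P f.
  apply: (flag_ind rib (P := P) (f0 := r)) => [|g|g]; first exact: connect0.
    by rewrite /P bvo.
  case: (boolP (wr t g)) => gw; last first.
    have -> // : P (s g) = P g.
    by rewrite /P [bv (s g)]/bv [bv g]/bv wr_csucc // (negPf gw) vs.
  case: (eqVneq g r) => [->|gr]; first by rewrite sr.
  move=> Pg; apply: connect_trans Pg (connect1 _); rewrite -bvo.
  have ogb : ~~ wr t (o g) by rewrite wr_oflag // negbK.
  have -> : s g = opp (o g) by rewrite /opp (negPf ogb) oK.
  by apply: adj; apply: bk_off => //; rewrite (inj_eq (can_inj oK)).
have all u : connect (adjacency C) (toV (bv r)) u.
  have [f fu] := flag_at r (val u) rib; have := Pall f; rewrite /P.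
  have -> // : toV (bv f) = u.
  apply: val_inj; rewrite val_toV_bv /bv -fu ifN // /wr fu negb_or; exact: (valP u).
by move=> u w; apply: connect_trans (all w); rewrite cS.
Qed.

Let cycle_lab_surj i : exists f, clab C f = i.
Proof.
case: (unliftP ord0 i) => [j ->|->]; last first.
  by exists (toF (s (o r))); apply/eqP; rewrite /= toFK // lab0 // wr_csucc.
have [_ /(_ j)[u [uj _]] _ _ _] := treeT.
have [f fu] := flag_at r u rib; exists (toF f).
have fW : white t (v f) by rewrite fu /white uj.
rewrite /= toFK /lab ?fu ?uj //; apply: wr_off; first exact: white_wr.
by apply: contraTneq fW => ->; rewrite rr root_black.
Qed.

Let card_blackV : (#|{: blackV}| + n.+1 = #|V|)%N.
Proof.
rewrite card_sig -[RHS](cardC (white t)) (card_white treeT) addnC addSn -addnS; congr addn.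
have rb : troot t \in [predC (white t)] by exact: (root_black treeT).
rewrite [RHS](cardD1 (troot t)) rb add1n.
by congr _.+1; apply: eq_card => u; rewrite !inE andbC.
Qed.

Lemma cactus_of_is_cactus : is_cactus C.
Proof.
have baseE : val (cbase C) = s (o r) by rewrite /= toFK.
split.
- split.
  + split; first exact: ribC.
    (* [t] has [n.+1] more vertices and one more edge than [C], so the edge count of a tree becomes
       the genus formula with [n.+1] cycles. *)
    rewrite /genus0 (ncycles_labelled ribC fconnect_cnextC cycle_lab_surj).
    rewrite card_blackV (tree_card treeT) addn2; congr _.+1.
    apply/eqP; rewrite -(eqn_pmul2r (isT : 0 < 2)%N) -card_flags // mulSn -card_flags //.
    rewrite card_sig -[X in X == _](cardC (pred2 r (o r))) card2 (eq_sym r) (oflag_neq rib r).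
    by apply/eqP; congr (_ + _)%N; apply: eq_card => f; rewrite !inE negb_or.
  + by move=> f; rewrite !outerC oppE wr_opp; case: wr.
  + rewrite valence_gt1 //; apply/existsP; exists (cbase C); rewrite eqxx /=.
    apply/eqP => /(congr1 (wr t \o val)) /=; rewrite -[toF (suc _)]/(csucc C (cbase C)).
    by rewrite sucE wr_suc; case: wr.
  + move=> u ub; have [f fu] := flag_at r (val u) rib.
    have fb : ~~ wr t f by rewrite /wr fu negb_or; exact: (valP u).
    have bvg g : wr t g = false -> bv g = v g by rewrite /bv => ->.
    have vg g : v g = val u -> g != o r.
      move=> gu; apply: contraNneq ub => gr; apply/eqP/val_inj.
      by rewrite /= val_toV_bv toFK // bvg ?wr_csucc ?(negPf orb) // vs -gr.
    have fF : off f by apply: bk_off => //; apply: vg.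
    have sfb : ~~ wr t (s f) by rewrite wr_csucc.
    have sfF : off (s f) by apply: bk_off => //; apply: vg; rewrite vs.
    have ofw : wr t (o f) by rewrite wr_oflag.
    have ofF : off (o f).
      apply: wr_off => //; apply: contraTneq fF => E.
      by rewrite /off -[f]oK E !eqxx andbF.
    (* Away from the base there are two distinct black flags [f] and [s f], and also the lobe flag
       [o f]. *)
    apply/card_gt2P; exists (toF f), (toF (s f)), (toF (o f)); rewrite !inE -!val_eqE /=.
    rewrite !val_toV_bv !toFK // !(bvg f, bvg (s f)) ?(negPf fb) ?(negPf sfb) //.
    rewrite /bv ofw oK vs fu eqxx; split=> //; split.
    * by rewrite eq_sym black_succ_neq.
    * by apply: contraTneq ofw => <-.
    * by apply: contraTneq ofw => ->.
- by split; [exact: fconnect_cnextC|exact: cycle_lab_surj].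
- by apply/eqP; rewrite /= toFK // lab0 // wr_csucc.
- split=> f.
    rewrite /= toFK ?off_opp ?offP // /len wr_opp /opp.
    by case: (boolP (wr t (val f))) => fw /=; rewrite ?oK ?f_finv.
  rewrite /= /len; have fF := offP f.
  have pos g : off g -> wr t g -> 0 < ext x g.
    by move=> gF gw; have [e _ ->] := ext_white x (off_wr gF gw).
  case: ifP => fw; first exact: pos.
  have -> : s (o (val f)) = opp (val f) by rewrite /opp fw.
  by apply: pos; rewrite ?off_opp // wr_opp fw.
Qed.

Lemma cactus_of_type : exists p q, tree_iso (topological_type C) t p q /\
  forall f, q (inl f) = val f.
Proof.
have cC := cactus_of_is_cactus.
pose q (f : offF + bool) : F :=
  match f with inl f => val f | inr true => o r | inr false => r end.
pose q' f : offF + bool := if f == r then inr false else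
  if f == o r then inr true else inl (toF f).
have bq : bijective q.
  exists q' => [[f|[]]|f]; rewrite /q' /=.
  - have /andP[/negPf-> /negPf->] := valP f.
    by congr inl; apply: val_inj; rewrite toFK //; exact: offP.
  - by rewrite (negPf (oflag_neq rib r)) eqxx.
  - by rewrite eqxx.
  - case: (eqVneq f r) => [->//|fr]; case: (eqVneq f (o r)) => [->//|fo] /=.
    by rewrite toFK // /off fr fo.
have finvN f : wr t (val f) -> val (finv (cnext C) f) = s (val f).
  move=> fw; have fF := offP f.
  have sfF : off (s (val f)).
    apply: wr_off; first by rewrite wr_csucc.
    have /andP[fr _] := fF; apply: contra fr => /eqP E.
    by apply/eqP/sI; rewrite E sr.
  have -> : finv (cnext C) f = toF (s (val f)); last by rewrite toFK.
  apply: (cnext_inj ribC); rewrite f_finv; last exact: (cnext_inj ribC).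
  by apply: val_inj; rewrite cnextE toFK // /nxt wr_csucc // fw finv_f.
have qo_inl (f : offF) : o (val f) = q (type_opp C (inl f)).
  case: (boolP (wr t (val f))) => fw.
    rewrite type_opp_inner ?outerC ?fw // /q oppE /opp finvN // wr_csucc // fw.
    by rewrite finv_f.
  rewrite type_opp_outer ?outerC // /q cnextE oppE /nxt wr_opp fw /=.
  by rewrite /opp (negPf fw) finv_f.
have qo f : o (q f) = q (type_opp C f).
  by case: f => [f|[]]; [exact: qo_inl|exact: oK|].
have qs_inl (f : offF) : s (val f) = q (type_succ C (inl f)).
  case: (boolP (wr t (val f))) => fw.
    by rewrite type_succ_inner ?outerC ?fw // /q finvN.
  rewrite type_succ_outer ?outerC // -[_ == cbase C]val_eqE !sucE /= toFK //.
  have -> : suc (suc (val f)) = skip s (o r) (val f).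
    by rewrite {1}/suc wr_suc fw /suc (negPf fw) oK.
  have /andP[_ fo] := valP f.
  rewrite /skip; case: (eqVneq (s (val f)) (o r)) => [->|sf]; first by rewrite eqxx.
  rewrite (inj_eq sI) (negPf fo) /q !sucE.
  rewrite {1}/suc wr_suc fw /suc (negPf fw) oK /skip (negPf sf) //.
have qs f : s (q f) = q (type_succ C f).
  by case: f => [f|[]]; [exact: qs_inl|rewrite /q /= toFK|exact: sr].
have [p iso] := graph_iso_of_flags (inr true) (type_ribbon cC) rib bq qo qs.
exists p, q; split=> //; split=> // [u|]; last by rewrite -rr -[r]/(q (inr false)) (vert_iso iso).
have [f <-] := flag_at (inr true) u (type_ribbon cC).
rewrite -(vert_iso iso); case: f => [f|[]] /=.
- by rewrite /lab; case: tcol => [i|]; rewrite ?liftK ?unlift_none.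
- by have /andP[] := blackE orb; rewrite /white negbK => /eqP.
- by have := root_black treeT; rewrite /white negbK rr => /eqP.
Qed.

End CactusOfTree.

Lemma cactus_of_tree (R : realType) (n : nat) (V F : finType) (t : tree_data n V F)
    (x : wflag t -> R) : is_tree t -> (forall e, 0 < x e) ->
  exists (c : ord_cactus R n) p q, tree_iso (topological_type c) t p q /\
    forall f e, q (inl f) = val e -> clen c f = x e.
Proof.
move=> tT x0; have [r rr] := root_flag_exists tT.
have cC := cactus_of_is_cactus tT x0 rr.
have [p [q [isoT qE]]] := cactus_of_type tT x0 rr.
have [c [p1 [q1 [iso cb cl ce]]]] := ord_cactus_exists cC.
have [P [Q [isoP QE]]] := type_iso cC (cdataP c) iso cb cl.
have [P' [Q' [_ _ QK _ isoP']]] := tree_iso_sym isoP.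
exists c, (p \o P'), (q \o Q'); split; first exact: tree_iso_trans isoP' isoT.
move=> f e /=; have [_ [q1' _ q1'K] _ _ _] := iso.
rewrite -(q1'K f) -QE QK qE ce /= => ->.
by rewrite (white_wr (valP e)) ext_val.
Qed.

(** * Points of the glued cells *)

Local Open Scope ring_scope.
Local Open Scope quotient_scope.

Section Cells.
Context {R : realType} {n : nat}.
Implicit Type T : trees n.

Lemma tree_repr_iso (t : ord_tree n) :
  exists p q, tree_iso t (repr (\pi_(trees n) t)) p q.
Proof.
have /eqmodP : t = repr (\pi_(trees n) t) %[mod trees n] by rewrite reprK.
by rewrite /= => /asboolP.
Qed.

Lemma trees_eq T T' p q : tree_iso (repr T) (repr T') p q -> T = T'.
Proof.
move=> iso; rewrite -[T]reprK -[T']reprK; apply/eqmodP/asboolP.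
by exists p, q.
Qed.

(** The isomorphism forces [T = T']; it is then an automorphism, hence the identity on flags. *)
Lemma cell_eq (A : forall T, set (coords R T)) T T' (x : cell A T) (y : cell A T') p q :
  tree_iso (repr T) (repr T') p q ->
  (forall (e : wflag (repr T)) (e' : wflag (repr T')),
    val e' = q (val e) -> val y e' = val x e) ->
  existT _ T x = existT _ T' y :> cells A.
Proof.
move=> iso; have TT' := trees_eq iso; subst T' => xy.
congr existT; apply: val_inj; apply/funext => e.
by apply/esym/xy; rewrite (tree_automorphism (tdataP _) iso).
Qed.

Definition root_flag (t : ord_tree n) := sval (cid (root_flag_exists (tdataP t))).

Lemma vert_root_flag (t : ord_tree n) : vert t (root_flag t) = troot t.
Proof. by rewrite /root_flag; case: cid. Qed.

Definition cell_word (A : forall T, set (coords R T)) (x : cells A) :=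
  word (t := repr (projT1 x)) (val (projT2 x)) (root_flag (repr (projT1 x))).

Definition inner_point (A : forall T, set (coords R T)) (x : cells A) :=
  forall e, 0 < val (projT2 x) e.

Lemma face_glue_word A (x y : cells A) : face_glue x y -> cell_word x = cell_word y.
Proof.
move=> [h [h1 xh [p [q [deg xy]]]]]; apply/esym.
apply: (degen_word (tdataP _) (tdataP _) (valP h) h1 deg) => //.
- by rewrite ext_val.
- exact: vert_root_flag.
- exact: vert_root_flag.
Qed.

Lemma glue_word A (x y : cells A) :
  clos_refl_sym_trans _ (@face_glue R n A) x y -> cell_word x = cell_word y.
Proof. by elim=> [u w /face_glue_word|//|u w _ ->|u w z _ -> _ ->]. Qed.

Lemma inner_point_word_inj A (x y : cells A) : inner_point x -> inner_point y ->
  cell_word x = cell_word y -> x = y.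
Proof.
move=> x0 y0 xy; have [||p [q [iso pq]]] := word_tree_iso (tdataP _) (tdataP _)
    (vert_root_flag _) (vert_root_flag _) _ _ xy.
- by move=> e; rewrite gt_eqF.
- by move=> e; rewrite gt_eqF.
case: x y x0 y0 xy p q iso pq => [T x] [T' y] _ _ _ p q /= iso pq.
exact: cell_eq iso pq.
Qed.

Lemma to_glued_eq A (x y : cells A) :
  to_glued x = to_glued y <-> clos_refl_sym_trans _ (@face_glue R n A) x y.
Proof.
split=> [/eqmodP /asboolP//|xy].
by apply/eqmodP/asboolP.
Qed.

Lemma to_glued_word A (x y : cells A) :
  to_glued x = to_glued y -> cell_word x = cell_word y.
Proof. by move=> /to_glued_eq /glue_word. Qed.

(** Induction on the number of flags: a coordinate 0 allows a collapse, which loses flags. *)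
Lemma reduce_product (y : cells (@product_cell R n)) : exists y',
  inner_point y' /\ clos_refl_sym_trans _ (@face_glue R n (@product_cell R n)) y y'.
Proof.
have [m] := ubnP (tnf (repr (projT1 y))); elim: m y => // m IH y ym.
case: (pselect (inner_point y)) => [yi|/existsNP[h /negP]].
  by exists y; split=> //; exact: rst_refl.
have [y0 y1] := set_mem (valP (projT2 y)).
rewrite lt_neqAle y0 andbT negbK => /eqP/esym yh.
set t := repr (projT1 y) in h yh.
have tT : is_tree t := tdataP t.
have hw : white t (vert t (val h)) := valP h.
(* If [h] were alone at its vertex, the coordinates there would sum to 0 instead of 1. *)
have h1 : (1 <= arity t (vert t (val h)))%N.
  rewrite /arity -subn1 subn_gt0 ltnNge; apply/negP => val1.
  have := y1 _ hw; rewrite (big_pred1 h) => [/eqP|e]; first by rewrite yh eq_sym oner_eq0.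
  apply/eqP/eqP => [eh|->//]; apply: val_inj.
  by move/card_le1_eqP: val1; apply; rewrite inE /= ?eh.
have [t' [p [q deg]]] := degeneration_exists tT hw h1.
have [p1 [q1 iso]] := tree_repr_iso t'.
have [q2 deg'] := is_degeneration_iso deg iso.
have [[p_surj _] [q2I codE] vq _ [col _]] := deg'.
set T' := \pi_(trees n) t' in iso deg' p_surj q2I codE vq col.
pose z : coords R T' := fun e => ext (t := t) (val (projT2 y)) (q2 (val e)).
have zw (f' : wflag (repr T')) (f : wflag t) : q2 (val f') = val f -> z f' = val (projT2 y) f.
  by rewrite /z => ->; rewrite ext_val.
have zA : product_cell z.
  split=> [e|u uw]; first by rewrite /z /ext; case: insub.
  have [w wu] := p_surj u; rewrite -wu.
  have ww : white t w by move: uw; rewrite /white -wu col.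
  by rewrite (degen_sum (x := val (projT2 y)) tT hw deg' _ zw ww) ?ext_val ?y1.
pose y' : cells (@product_cell R n) := existT _ T' (exist _ z (mem_set zA)).
have yy' : face_glue y y' by exists h; split=> //; exists (p1 \o p), q2.
have [|y'' [y''i gl]] := IH y'.
  (* The image of [q2] misses [h], so the number of flags drops. *)
  suff lt : (tnf (repr T') < tnf t)%N by exact: leq_trans lt ym.
  have : (#|codom q2| < #|'I_(tnf t)|)%N.
    apply/proper_card/properP; split; first exact/subset_predT.
    by exists (val h); rewrite // codE eqxx.
  by rewrite card_codom // !card_ord.
by exists y''; split=> //; apply: rst_trans gl; exact: rst_step.
Qed.

End Cells.

Local Open Scope classical_set_scope.

Lemma ptws_continuous (X : topologicalType) (I : Type) (T : I -> topologicalType)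
    (f : X -> prod_topology T) :
  (forall i, continuous (fun x => f x i)) -> continuous f.
Proof.
move=> fi x; apply/cvg_sup => i.
exact: (@continuous_comp_initial _ X (T i) (fun g => g i) f (fi i)).
Qed.

Lemma coord_continuous (R : realType) (n : nat) (A : forall T : trees n, set (coords R T))
    (T : trees n) (e : wflag (repr T)) : continuous (fun x : cell A T => val x e : R).
Proof.
move=> x; apply: (@continuous_comp _ _ _ (set_val : cell A T -> coords R T) (fun f => f e)).
  exact: initial_continuous.
exact: (@proj_continuous _ (fun=> R : topologicalType) e).
Qed.

(** * Continuous maps between glued spaces *)

Section CellMap.
Context {R : realType} {n : nat}.
Implicit Type T : trees n.
Variables (A B : forall T : trees n, set (coords R T)).
Variable f : forall T, coords R T -> coords R T.
Hypothesis fAB : forall T (x : coords R T), A x -> B (f x).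

Definition cell_map (x : cells A) : cells B :=
  existT _ (projT1 x) (exist _ (f (val (projT2 x))) (mem_set (fAB (set_mem (valP (projT2 x)))))).

Definition glued_map (y : glued A) : glued B := to_glued (cell_map (repr y)).

Hypothesis f_face : forall T T' (x : cell A T) (y : cell A T')
    (h : wflag (repr T)) p q,
  val x h = 0 -> is_degeneration (repr T) (val h) (repr T') p q ->
  (forall (e' : wflag (repr T')) (e : wflag (repr T)), q (val e') = val e -> val y e' = val x e) ->
  f (val x) h = 0 /\ forall (e' : wflag (repr T')) (e : wflag (repr T)),
    q (val e') = val e -> f (val y) e' = f (val x) e.
Hypothesis f_cont : forall T (e : wflag (repr T)),
  continuous (fun x : cell A T => f (val x) e : R).

Lemma cell_map_face x y : face_glue x y -> face_glue (cell_map x) (cell_map y).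
Proof.
move=> [h [h1 xh [p [q [deg xy]]]]]; exists h.
have [fh fxy] := f_face xh deg xy; split=> //.
by exists p, q.
Qed.

Lemma glued_map_to_glued x : glued_map (to_glued x) = to_glued (cell_map x).
Proof.
have H u w : clos_refl_sym_trans _ (@face_glue R n A) u w ->
    clos_refl_sym_trans _ (@face_glue R n B) (cell_map u) (cell_map w).
  elim=> {u w} [u w /cell_map_face|u|u w _|u w z _ + _].
  - exact: rst_step.
  - exact: rst_refl.
  - exact: rst_sym.
  - exact: rst_trans.
apply/to_glued_eq/H/to_glued_eq.
by rewrite /to_glued reprK.
Qed.

(** The quotient and sum topologies reduce continuity to single cells, and there to single
    coordinates. *)
Lemma glued_map_continuous : continuous glued_map.
Proof.
apply/quotient_continuous.
have -> : glued_map \o \pi_(glued A) = to_glued (A := B) \o cell_map.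
  by apply/funext => x; exact: glued_map_to_glued.
apply/continuousP => U oU; apply/sigT_openP => T.
pose fT (x : cell A T) : cell B T :=
  exist _ (f (val x)) (mem_set (fAB (set_mem (valP x)))).
have fTc : continuous fT.
  apply: continuous_comp_initial; apply: ptws_continuous => e; exact: f_cont.
have oU' : open ((to_glued (A := B)) @^-1` U) by exact: oU.
move/sigT_openP: oU' => /(_ T) oUT.
by move/continuousP: fTc => /(_ _ oUT).
Qed.

End CellMap.

(** * Coordinates of cacti *)

Section TypeCoordinates.
Context {R : realType} {n : nat} {V F V' F' : finType}.
Variables (c : cactus_data R n V F) (t : tree_data n V' F').
Variables (p : V + 'I_n + unit -> V') (q : F + bool -> F').
Hypotheses (cC : is_cactus c) (iso : tree_iso (topological_type c) t p q).

Lemma type_flag (e : wflag t) : exists2 f, q (inl f) = val e & ~~ outer c f.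
Proof.
have [isoG tc _] := iso; have [_ [q' qK q'K] _ _ _] := isoG.
have := valP e; rewrite -{1}(q'K (val e)) (vert_iso isoG) (white_iso _ iso).
case E: (q' (val e)) => [f|[]] //; rewrite type_white // => fi.
by exists f; rewrite // -E q'K.
Qed.

Lemma type_flag_white f : ~~ outer c f -> white t (vert t (q (inl f))).
Proof.
by have [isoG _ _] := iso; rewrite (vert_iso isoG) (white_iso _ iso) type_white.
Qed.

Lemma type_coords (l : F -> R) : exists x : wflag t -> R,
  forall f e, q (inl f) = val e -> x e = l f.
Proof.
have /choice[g gP] : forall e : wflag t, exists f, q (inl f) = val e.
  by move=> e; have [f fe _] := type_flag e; exists f.
exists (l \o g) => f e; rewrite -gP /= => fe; congr l.
have [[_ /bij_inj qI _ _ _] _ _] := iso.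
by have [->] := qI _ _ fe.
Qed.

Variables (l : F -> R) (x : wflag t -> R).
Hypothesis xl : forall f e, q (inl f) = val e -> x e = l f.

Lemma type_sum (P : pred V') : \sum_(e | P (vert t (val e))) x e =
  \sum_(f | ~~ outer c f && P (vert t (q (inl f)))) l f.
Proof.
have /choice[g gP] : forall e : wflag t, exists f, q (inl f) = val e /\ ~~ outer c f.
  by move=> e; have [f] := type_flag e; exists f.
have [[_ /bij_inj qI _ _ _] _ _] := iso.
rewrite [RHS](reindex_omap g (fun f => insub (q (inl f)))) /=.
  apply: eq_big => [e|e _]; last by apply: xl; have [] := gP e.
  by have [-> ->] := gP e; rewrite /= valK eqxx andbT.
move=> f /andP[/type_flag_white fw _]; rewrite insubT /=; congr Some.
by have [/qI[]] := gP (Sub (q (inl f)) fw).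
Qed.

Lemma type_sum_total : \sum_e x e = \sum_(f | ~~ outer c f) l f.
Proof. by rewrite (type_sum predT); apply: eq_bigl => f; rewrite andbT. Qed.

Lemma type_sum_lobe v i : is_tree t -> tcol t v = Some i ->
  \sum_(e | vert t (val e) == v) x e = \sum_(f | clab c f == lift ord0 i) l f.
Proof.
move=> tT vi; rewrite (type_sum (pred1 v)); apply: eq_bigl => f /=.
have [isoG tc _] := iso; rewrite (vert_iso isoG) outer_unlift //.
have tcE := tc (type_vert c (inl f)); move: tcE; rewrite /=.
case: unliftP => [j ->|->] /= tcE; last by rewrite (negPf (neq_lift _ _)).
rewrite (inj_eq (@lift_inj _ ord0)); apply/eqP/eqP => [E|ji].
  by apply: Some_inj; rewrite -tcE E vi.
by apply: (white_label tT); rewrite /white tcE // vi ji.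
Qed.

End TypeCoordinates.

Section CactusSums.
Context {R : realType} {n : nat} {V F V' F' : finType}.
Variables (c : cactus_data R n V F) (c' : cactus_data R n V' F').
Variables (p : V -> V') (q : F -> F') (k : R).
Hypotheses (iso : cactus_iso (rescale k c) c' p q).

Lemma cycle_length_iso i : cycle_length c' i = k * cycle_length c i.
Proof.
have [[_ bq _ _ _] _ cl ce] := iso; have [q' qK q'K] := bq.
rewrite /cycle_length mulr_sumr (reindex q); last exact: onW_bij.
by apply: eq_big => f; rewrite ?cl // ce.
Qed.

Lemma total_length_iso : is_cactus c -> is_cactus c' ->
  total_length c' = k * total_length c.
Proof.
move=> cC cC'; rewrite !total_length_lobes // mulr_sumr.
by apply: eq_bigr => i _; exact: cycle_length_iso.
Qed.

End CactusSums.

Lemma cactus_iso_rescale (R : realType) (n : nat) (V F V' F' : finType)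
    (c : cactus_data R n V F) (c' : cactus_data R n V' F') p q (k : R) :
  cactus_iso c c' p q -> cactus_iso (rescale k c) (rescale k c') p q.
Proof. by case=> iso cb cl ce; split=> // f /=; rewrite ce. Qed.

Lemma rescale1 (R : realType) (n : nat) (V F V' F' : finType)
    (c : cactus_data R n V F) (c' : cactus_data R n V' F') p q :
  cactus_iso (rescale 1 c) c' p q <-> cactus_iso c c' p q.
Proof. by split=> -[iso cb cl ce]; split=> // f; rewrite ce /= mul1r. Qed.

Section Coordinates.
Context {R : realType} {n : nat}.
Implicit Types (c : PCact R n) (x y : cells (@simplex_cell R n)).

Lemma cactus_repr_iso (G : ord_cactus R n) :
  exists p q, cactus_iso G (repr (\pi_(Cact_set R n) G)) p q.
Proof.
have /eqmodP : G = repr (\pi_(Cact_set R n) G) %[mod Cact_set R n] by rewrite reprK.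
by rewrite /= => /asboolP.
Qed.

Lemma Cact_eqP (c c' : Cact_set R n) :
  c = c' <-> exists p q, cactus_iso (repr c) (repr c') p q.
Proof.
split=> [->|[p [q iso]]].
  exists id, id; split=> //; exact: graph_iso_refl.
by rewrite -[c]reprK -[c']reprK; apply/eqmodP/asboolP; exists p, q.
Qed.

Lemma PCact_eqP (c c' : Cact_set R n) : \pi_(PCact R n) c = \pi_(PCact R n) c' <->
  exists k : R, 0 < k /\ exists p q, cactus_iso (rescale k (repr c)) (repr c') p q.
Proof. by split=> [/eqmodP /asboolP|] // h; apply/eqmodP/asboolP. Qed.

Lemma PCact_repr_iso (c : Cact_set R n) : exists k : R, 0 < k /\
  exists p q, cactus_iso (rescale k (repr c)) (repr (repr (\pi_(PCact R n) c))) p q.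
Proof. by apply/PCact_eqP; rewrite reprK. Qed.

Lemma total_length_pos (G : ord_cactus R n) : 0 < total_length G.
Proof. exact: total_length_gt0. Qed.

Lemma has_coords_exists c : exists x, has_coords c x.
Proof.
set G : ord_cactus R n := repr (repr c); have GC := cdataP G.
have [t [p0 [q0 iso0]]] := ord_tree_exists (type_is_tree GC).
have [p1 [q1 iso1]] := tree_repr_iso t.
have iso := tree_iso_trans iso0 iso1; set T := \pi_(trees n) t in p1 q1 iso1 iso.
set p := p1 \o p0 in iso; set q := q1 \o q0 in iso.
have [x xP] := type_coords GC iso (fun f => clen G f / total_length G).
have [_ _ _ [_ lenG]] := GC; have tG := total_length_pos G.
have x_gt0 e : 0 < x e.
  by have [f fe _] := type_flag GC iso e; rewrite (xP _ _ fe) divr_gt0.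
have xA : simplex_cell (x : coords R T).
  split=> [e||v vw].
  - exact: ltW.
  - rewrite (type_sum_total GC iso xP) -mulr_suml -total_length_inner //.
    by rewrite divff // gt_eqF.
  - have [f fv] := flag_at (root_flag (repr T)) v (tree_ribbon (tdataP (repr T))).
    have fw : white (repr T) (vert (repr T) f) by rewrite fv.
    rewrite (bigD1 (Sub f fw)) /= ?fv // ltr_pwDl // sumr_ge0 // => e _; exact: ltW.
exists (existT _ T (exist _ (x : coords R T) (mem_set xA))).
by exists p, q; split=> // f e fe; exact: xP.
Qed.

(** Uniqueness holds in the disjoint union, before any gluing: both trees are isomorphic to the same
    type, so [cell_eq] applies. *)
Lemma has_coords_uniq c x y : has_coords c x -> has_coords c y -> x = y.
Proof.
case: x y => [T x] [T' y] [p [q [iso xP]]] [p' [q' [iso' yP]]].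
have [p1 [q1 [pK _ qK q1K iso1]]] := tree_iso_sym iso.
apply: cell_eq (tree_iso_trans iso1 iso') _ => e e' ee'.
have [f fe _] := type_flag (cdataP _) iso e.
rewrite (xP f e fe) (yP f) //.
by apply/esym/(etrans ee'); congr q'; rewrite -fe qK.
Qed.

Lemma has_coords_inner c x : has_coords c x -> inner_point x.
Proof.
move=> [p [q [iso xP]]] e; have [f fe _] := type_flag (cdataP _) iso e.
have [_ _ _ [_ lenG]] := cdataP (repr (repr c)).
by rewrite (xP _ _ fe) divr_gt0 // total_length_pos.
Qed.

(** [type_iso_inv] recovers the labelled ribbon graph; the lengths then agree up to the ratio of the
    total lengths. *)
Lemma has_coords_inj c c' x : has_coords c x -> has_coords c' x -> c = c'.
Proof.
case: x => [T x] [p [q [iso xP]]] [p' [q' [iso' yP]]].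
have [p1 [q1 [pK p1K qK q1K iso1]]] := tree_iso_sym iso'.
set G := repr (repr c) in iso xP; set G' := repr (repr c') in iso' yP iso1.
have GC := cdataP G; have GC' := cdataP G'.
have [pc [qc [qcE isoc cb cl]]] := type_iso_inv GC GC' (tree_iso_trans iso iso1).
rewrite -[c]reprK -[c']reprK; apply/PCact_eqP.
have tG := total_length_pos G; have tG' := total_length_pos G'.
have [_ _ _ [leno _]] := GC; have [_ _ _ [leno' _]] := GC'.
exists (total_length G' / total_length G); split; first exact: divr_gt0.
exists pc, qc; split=> //.
have inner f : ~~ outer G f -> clen G' (qc f) = total_length G' / total_length G * clen G f.
  move=> fi; pose e : wflag (repr T) := Sub (q (inl f)) (type_flag_white GC iso fi).
  have := xP f e erefl; rewrite (yP (qc f) e); last by rewrite -qcE /= q1K.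
  move=> E; rewrite mulrAC -mulrA -E mulrCA divff ?mulr1 //.
  by rewrite gt_eqF.
(* An outer flag has the length of its opposite, which is inner. *)
move=> f; case: (boolP (outer G f)) => fo; last exact: inner.
by rewrite /= -leno -leno' (oflag_iso isoc) inner // outer_oflag // fo.
Qed.

(** The chosen representative of the class differs from [G] by an isomorphism and a factor [k],
    which cancels in the quotient by the total length. *)
Lemma has_coords_of (G : ord_cactus R n) T (x : cell (@simplex_cell R n) T) p q :
  tree_iso (topological_type G) (repr T) p q ->
  (forall f e, q (inl f) = val e -> val x e = clen G f / total_length G) ->
  has_coords (\pi_(PCact R n) (\pi_(Cact_set R n) G)) (existT _ T x).
Proof.
move=> iso xP; set c := \pi_(Cact_set R n) G.
have [p0 [q0 iso0]] := cactus_repr_iso G.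
have [k [k0 [p1 [q1 iso1]]]] := PCact_repr_iso c.
have iso2 := cactus_iso_trans (cactus_iso_rescale k iso0) iso1.
set G' := repr (repr (\pi_(PCact R n) c)) in p1 q1 iso1 iso2.
have tot := total_length_iso iso2 (cdataP G) (cdataP G').
have [isoG cb cl ce] := iso2.
have [P [Q [isoT QE]]] := type_iso (c := G) (cdataP G) (cdataP G') isoG cb cl.
have [P' [Q' [_ _ QK Q'K isoT']]] := tree_iso_sym isoT.
exists (p \o P'), (q \o Q'); split; first exact: tree_iso_trans isoT' iso.
move=> f e fe; have [_ [q' qK q'K] _ _ _] := isoG.
rewrite -/G' -(q'K f) ce tot /= -mulf_div divff ?gt_eqF // mul1r.
apply: xP; apply: etrans fe; congr q.
by rewrite -[f in RHS]q'K -QE QK.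
Qed.

End Coordinates.

(** * Normalization of the lobes *)

Section Normalization.
Context {R : realType} {n : nat}.
Implicit Type T : trees n.

Definition scale T (x : coords R T) : coords R T := fun e => x e / n%:R.

Definition lobe_sum T (x : coords R T) (e : wflag (repr T)) : R :=
  \sum_(e' | vert (repr T) (val e') == vert (repr T) (val e)) x e'.

Definition normalize T (x : coords R T) : coords R T := fun e => x e / lobe_sum x e.

Lemma sum_product_cell T (x : coords R T) : product_cell x -> \sum_e x e = n%:R.
Proof.
move=> [_ x1]; rewrite (partition_big (fun e => vert (repr T) (val e)) (white (repr T))) /=.
  by rewrite (eq_bigr (fun=> 1)) // sumr_const (card_white (tdataP (repr T))).
by move=> e _; exact: (valP e).
Qed.

Lemma scale_simplex (n_gt0 : (0 < n)%N) T (x : coords R T) :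
  product_cell x -> simplex_cell (scale x).
Proof.
move=> xP; have n0 : 0 < n%:R :> R by rewrite ltr0n.
have [x0 x1] := xP; split=> [e||v vw].
- by rewrite divr_ge0 // ltW.
- by rewrite -mulr_suml sum_product_cell // divff // gt_eqF.
- by rewrite -mulr_suml x1 // divr_gt0.
Qed.

Lemma normalize_product T (x : coords R T) :
  simplex_cell x -> product_cell (normalize x).
Proof.
move=> [x0 _ x1]; split=> [e|v vw].
  by rewrite divr_ge0 // sumr_ge0.
rewrite (eq_bigr (fun e => x e / \sum_(e' | vert (repr T) (val e') == v) x e')).
  by rewrite -mulr_suml divff // gt_eqF // x1.
by move=> e /eqP ev; rewrite /normalize /lobe_sum ev.
Qed.

Let face_hyp (A : forall T, set (coords R T)) (f : forall T, coords R T -> coords R T) :=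
  forall T T' (x : cell A T) (y : cell A T') (h : wflag (repr T)) p q,
  val x h = 0 -> is_degeneration (repr T) (val h) (repr T') p q ->
  (forall (e' : wflag (repr T')) (e : wflag (repr T)), q (val e') = val e -> val y e' = val x e) ->
  f T (val x) h = 0 /\ forall (e' : wflag (repr T')) (e : wflag (repr T)),
    q (val e') = val e -> f T' (val y) e' = f T (val x) e.

Lemma scale_face A : face_hyp A scale.
Proof.
move=> T T' x y h p q xh deg xy; rewrite /scale xh mul0r; split=> // e' e ee'.
by rewrite (xy _ _ ee').
Qed.

Lemma normalize_face A : face_hyp A normalize.
Proof.
move=> T T' x y h p q xh deg xy; rewrite /normalize xh mul0r; split=> // e' e ee'.
rewrite (xy _ _ ee') /lobe_sum; congr (_ / _).
have [_ _ vq _ _] := deg; rewrite vq ee'.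
apply: (degen_sum (tdataP _) (valP h) deg) => //; last exact: (valP e).
by rewrite ext_val.
Qed.

Lemma scale_continuous (A : forall T, set (coords R T)) T (e : wflag (repr T)) :
  continuous (fun x : cell A T => scale (val x) e : R).
Proof.
move=> x; have ? : Filter (nbhs x) by exact: nbhs_filter.
by apply: cvgM; [exact: (@coord_continuous R n A T e x)|exact: cvg_cst].
Qed.

Lemma normalize_continuous T (e : wflag (repr T)) :
  continuous (fun x : cell (@simplex_cell R n) T => normalize (val x) e : R).
Proof.
move=> x; have ? : Filter (nbhs x) by exact: nbhs_filter.
apply: cvgM; first exact: (@coord_continuous R n _ T e x).
apply: cvgV.
  have [_ _ x1] := set_mem (valP x).
  by rewrite gt_eqF // x1 //; exact: (valP e).
apply: cvg_big => [|e' _]; first exact: add_continuous.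
exact: (@coord_continuous R n _ T e' x).
Qed.

(** All lobe sums of the scaled point are [1/n], so normalizing multiplies by [n] again. *)
Lemma scaleK (n_gt0 : (0 < n)%N) y :
  cell_map normalize_product (cell_map (scale_simplex n_gt0) y) = y.
Proof.
case: y => T x; congr existT; apply: val_inj; apply/funext => e /=.
have [_ x1] := set_mem (valP x).
have n0 : n%:R != 0 :> R by rewrite pnatr_eq0 -lt0n.
rewrite /normalize /lobe_sum /scale -mulr_suml x1; last exact: (valP e).
by rewrite div1r invrK divfK.
Qed.

Lemma scale_inner (n_gt0 : (0 < n)%N) y :
  inner_point (cell_map (scale_simplex n_gt0) y) -> inner_point y.
Proof. by move=> yi e; have := yi e; rewrite /= /scale pmulr_lgt0 // invr_gt0 ltr0n. Qed.

Lemma normalize_inner x : inner_point x -> inner_point (cell_map normalize_product x).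
Proof.
move=> xi e /=; apply: divr_gt0; first exact: xi.
by have [_ _ ->] := set_mem (valP (projT2 x)); last exact: (valP e).
Qed.

End Normalization.

(** * Normalized cacti and their projective classes *)

Section Cact1.
Context {R : realType} {n : nat}.
Hypothesis n_gt0 : (0 < n)%N.
Let i1 : 'I_n.+1 := lift ord0 (Ordinal n_gt0).
Let i10 : i1 != ord0. Proof. by []. Qed.

Lemma Cact1_total (c : Cact_set R n) : Cact1 R n c -> total_length (repr c) = n%:R.
Proof.
move=> c1; rewrite (total_length_lobes (cdataP _)) (eq_bigr (fun=> 1)) //.
rewrite sumr_const; congr (_ *+ _).
by rewrite (cardC1 ord0 : #|[pred i : 'I_n.+1 | i != ord0]| = _) card_ord.
Qed.

(** Both cacti give length 1 to the lobe [i1], so the rescaling factor is 1. *)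
Lemma Cact1_proj_inj (c c' : Cact_set R n) : Cact1 R n c -> Cact1 R n c' ->
  \pi_(PCact R n) c = \pi_(PCact R n) c' -> c = c'.
Proof.
move=> c1 c'1 /PCact_eqP[k [k0 [p [q iso]]]]; apply/Cact_eqP; exists p, q.
have k1 : k = 1 by have := cycle_length_iso iso i1; rewrite (c1 _ i10) (c'1 _ i10) mulr1.
by apply/rescale1; rewrite -k1.
Qed.

(** This composite fixes a point just when its lobe sums are all [1/n]. They are so for the class of
    a normalized cactus, as the factor [k] of the representative cancels. *)
Lemma Cact1_coords (c : Cact_set R n) x : Cact1 R n c ->
  has_coords (\pi_(PCact R n) c) x ->
  cell_map (scale_simplex n_gt0) (cell_map normalize_product x) = x.
Proof.
case: x => T x c1 [p [q [iso xP]]]; congr existT; apply: val_inj; apply/funext => e /=.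
rewrite /scale /normalize /lobe_sum -mulrA -[RHS]mulr1; congr (_ * _).
have [k [k0 [p1 [q1 iso1]]]] := PCact_repr_iso c.
set G := repr (repr _) in p q iso xP p1 q1 iso1.
have := valP e; rewrite /white; case ei : tcol => [i|//] _.
rewrite (type_sum_lobe (cdataP G) iso xP (tdataP _) ei) -mulr_suml.
rewrite -/(cycle_length G (lift ord0 i)) (cycle_length_iso iso1).
rewrite (total_length_iso iso1 (cdataP _) (cdataP G)) Cact1_total // c1 // mulr1.
rewrite invf_div [k * _]mulrC mulfK ?divff ?gt_eqF //.
by rewrite ltr0n.
Qed.

Lemma Cact1_exists (y : cells (@product_cell R n)) : inner_point y ->
  exists2 c : Cact_set R n, Cact1 R n c &
    has_coords (\pi_(PCact R n) c) (cell_map (scale_simplex n_gt0) y).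
Proof.
case: y => T x x0; have [_ x1] := set_mem (valP x).
have tT := tdataP (repr T).
have [G [p [q [iso xl]]]] := cactus_of_tree (x := val x) tT x0.
have xl' f e : q (inl f) = val e -> val x e = clen G f by move=> /xl ->.
have G1 i : i != ord0 -> cycle_length G i = 1.
  case: (unliftP ord0 i) => [j ->|->]; rewrite ?eqxx // => _.
  have [_ /(_ j)[v [vj _]] _ _ _] := tT.
  by rewrite /cycle_length -(type_sum_lobe (cdataP G) iso xl' tT vj) x1 // /white vj.
have [p0 [q0 iso0]] := cactus_repr_iso G.
exists (\pi_(Cact_set R n) G).
  move=> i i0; rewrite (cycle_length_iso (c := G) (k := 1) (p := p0) (q := q0)) ?mul1r ?G1 //.
  exact/rescale1.
apply: (has_coords_of iso) => f e fe /=; rewrite /scale (xl' _ _ fe).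
congr (_ / _); rewrite (total_length_lobes (cdataP G)) (eq_bigr (fun=> 1)) // sumr_const.
by rewrite (cardC1 ord0 : #|[pred i : 'I_n.+1 | i != ord0]| = _) card_ord.
Qed.

Lemma Cact1_class_continuous :
  continuous (fun c : Cact1 R n => \pi_(PCact R n) (val c) : PCact R n).
Proof.
move=> c; apply: (@continuous_comp (Cact1 R n) (Cact R n) (PCact R n) set_val
    (fun c => (Cact_prod c).1)).
  exact: initial_continuous.
apply: (@continuous_comp (Cact R n) _ (PCact R n) (@Cact_prod R n) fst).
  exact: initial_continuous.
exact: cvg_fst.
Qed.

(** The total length is constant on [Cact1], so only the projective component of [Cact_prod]
    varies. *)
Lemma into_Cact1_continuous (X : topologicalType) (g : X -> Cact1 R n) :
  continuous (fun x => \pi_(PCact R n) (val (g x)) : PCact R n) -> continuous g.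
Proof.
move=> gc; apply: continuous_comp_initial; apply: continuous_comp_initial => y.
have gE x : (Cact_prod (val (g x))).2 = (Cact_prod (val (g y))).2.
  by apply: val_inj; rewrite /= !Cact1_total //; exact: set_mem (valP _).
have -> : (@Cact_prod R n) \o (set_val \o g) =
    fun x => (\pi_(PCact R n) (val (g x)) : PCact R n, (Cact_prod (val (g y))).2).
  by apply/funext => x; rewrite -(gE x).
have ? : Filter (nbhs y) by exact: nbhs_filter.
exact: (cvg_pair (gc y) (cvg_cst _)).
Qed.

End Cact1.

Theorem theorem3p5 (R : realType) (n : nat) (n_ge1 : (1 <= n)%N) :
  homeomorphic (Cact1 R n) (K R n).
Proof.
pose proj (c : Cact1 R n) : PCact R n := \pi_(PCact R n) (val c).
have /choice[coord coordP] := @has_coords_exists R n.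
pose S := glued_map (scale_simplex (R := R) n_ge1).
pose N := glued_map (@normalize_product R n).
pose F (c : Cact1 R n) : K R n := N (to_glued (coord (proj c))).
have SE y : S (to_glued y) = to_glued (cell_map (scale_simplex n_ge1) y).
  by apply: glued_map_to_glued; exact: scale_face.
have NE x : N (to_glued x) = to_glued (cell_map normalize_product x).
  by apply: glued_map_to_glued; exact: normalize_face.
(* The interior point [z] is kept in the statement because its scaling gives the coordinates of the
   chosen cactus. *)
have /choice[G GP] : forall y : K R n, exists c : Cact1 R n, exists2 z,
    y = to_glued z & has_coords (proj c) (cell_map (scale_simplex n_ge1) z).
  move=> y; have [z [z_in yz]] := reduce_product (repr y).
  have [c c1 cz] := Cact1_exists n_ge1 z_in.
  exists (exist _ c (mem_set c1) : Cact1 R n); exists z; last exact: cz.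
  by rewrite -[y]reprK; apply/to_glued_eq.
exists F, G; split.
- have coord_cont : continuous (fun c : PCact R n => to_glued (coord c)).
    (* [W] itself witnesses that the preimage is open, because coordinates are unique. *)
    apply/continuousP => W oW; exists W => // c x cx.
    by rewrite /= (has_coords_uniq (coordP c) cx).
  have proj_cont : continuous proj by exact: Cact1_class_continuous.
  move=> c; apply: (@continuous_comp _ _ _ (fun c => to_glued (coord (proj c))) N).
    apply: (@continuous_comp _ _ _ proj (fun c => to_glued (coord c))).
      exact: proj_cont.
    exact: coord_cont.
  apply: glued_map_continuous; first exact: normalize_face.
  exact: normalize_continuous.
- have projG_cont : continuous (proj \o G).
    apply/continuousP => U [W oW UW].
    (* Whatever [z] was chosen, membership of the class in [U] is read off from [S y]. *)
    have -> : (proj \o G) @^-1` U = S @^-1` W.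
      apply/funext => y; apply/propext; have [z yz cz] := GP y.
      by rewrite /preimage /= yz SE -yz; exact: UW cz.
    have : continuous S; last by move/continuousP; apply.
    by apply: glued_map_continuous; [exact: scale_face|exact: scale_continuous].
  exact: into_Cact1_continuous.
- move=> c; have [z yz cz] := GP (F c).
  have c1 : Cact1 R n (val c) by exact: set_mem (valP c).
  have x_in := has_coords_inner (coordP (proj c)).
  set x := coord (proj c) in x_in yz.
  (* Both points have positive coordinates and the same image in [K], hence the same word. *)
  have zE : z = cell_map normalize_product x.
    apply: inner_point_word_inj.
    + exact: scale_inner (has_coords_inner cz).
    + exact: normalize_inner.
    + apply: to_glued_word; exact: etrans (esym yz) (NE x).
  apply: val_inj; apply: (Cact1_proj_inj n_ge1) => //; first exact: set_mem (valP _).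
  apply: (@has_coords_inj _ _ _ _ x); last exact: coordP.
  have xE : cell_map (scale_simplex n_ge1) (cell_map normalize_product x) = x.
    by apply: Cact1_coords c1 _; exact: (coordP (proj c)).
  by rewrite -xE -zE.
- move=> y; have [z yz cz] := GP y.
  (* The coordinates chosen for [proj (G y)] can only be the scaled [z], and normalizing undoes the
     scaling. *)
  have xE := has_coords_uniq (coordP (proj (G y))) cz.
  apply: etrans (NE _) _; rewrite xE scaleK; exact: esym yz.
Qed.
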